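(* Let $p\in\{2,3\}$ and let $k\geq 1$ be an integer. The group $C_p\times C_p\times C_{p^k}$ is separable with respect to the class $\mathcal{K}_A$ of abelian groups if and only if $k=1$.
   Context: All groups are finite, and $C_n$ denotes the cyclic group of order $n$. For a subset $X$ of a group $G$ write $\underline{X}=\sum_{x\in X}x\in\mathbb{Z}G$ and $X^{-1}=\{x^{-1}:x\in X\}$. A subring $\mathcal{A}\subseteq\mathbb{Z}G$ is an $S$-ring (Schur ring) over $G$ if there is a partition $\mathcal{S}=\mathcal{S}(\mathcal{A})$ of $G$ such that (1) $\{e\}\in\mathcal{S}$; (2) $X\in\mathcal{S}$ implies $X^{-1}\in\mathcal{S}$; (3) $\mathcal{A}=\mathrm{Span}_{\mathbb{Z}}\{\underline{X}:X\in\mathcal{S}\}$. The elements of $\mathcal{S}(\mathcal{A})$ are called the basic sets of $\mathcal{A}$. For $X,Y,Z\in\mathcal{S}(\mathcal{A})$ let $c^Z_{X,Y}$ be the structure constants, defined by $\underline{X}\,\underline{Y}=\sum_{Z\in\mathcal{S}(\mathcal{A})}c^Z_{X,Y}\underline{Z}$. For $X\subseteq G$ put $R(X)=\{(g,xg):x\in X,\ g\in G\}$. Let $\mathcal{A}$ and $\mathcal{A}'$ be $S$-rings over groups $G$ and $G'$ respectively. An algebraic isomorphism from $\mathcal{A}$ to $\mathcal{A}'$ is a bijection $\varphi:\mathcal{S}(\mathcal{A})\to\mathcal{S}(\mathcal{A}')$ with $c^Z_{X,Y}=c^{Z^\varphi}_{X^\varphi,Y^\varphi}$ for all $X,Y,Z\in\mathcal{S}(\mathcal{A})$.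 A (combinatorial) isomorphism from $\mathcal{A}$ to $\mathcal{A}'$ is a bijection $f:G\to G'$ such that $\{R(X)^f:X\in\mathcal{S}(\mathcal{A})\}=\{R(X'):X'\in\mathcal{S}(\mathcal{A}')\}$, where $R(X)^f=\{(g^f,h^f):(g,h)\in R(X)\}$. Every such $f$ induces an algebraic isomorphism $\varphi_f$, given by $R(X)^f=R(X^{\varphi_f})$; an algebraic isomorphism $\varphi$ is said to be induced by $f$ if $\varphi=\varphi_f$. Let $\mathcal{K}$ be a class of groups. An $S$-ring $\mathcal{A}$ is separable with respect to $\mathcal{K}$ if every algebraic isomorphism from $\mathcal{A}$ to an $S$-ring over a group from $\mathcal{K}$ is induced by a combinatorial isomorphism. A finite group $G$ is separable with respect to $\mathcal{K}$ if every $S$-ring over $G$ is separable with respect to $\mathcal{K}$. $\mathcal{K}_A$ denotes the class of abelian groups. *)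

(* Defs.v *)
From HB Require Import structures.
From mathcomp Require Import all_boot all_order all_algebra all_fingroup.
From mathcomp Require Import all_solvable.

Set Implicit Arguments.
Unset Strict Implicit.
Unset Printing Implicit Defensive.

Import GroupScope GRing.Theory.
Local Open Scope ring_scope.

(* The integral group ring Z[gT]: coefficient functions gT -> int with the
   convolution product.  It is an alias because {ffun gT -> int} itself
   carries the pointwise product. *)
Definition group_ring (gT : finGroupType) : Type := {ffun gT -> int}.

HB.instance Definition _ (gT : finGroupType) :=
  GRing.Zmodule.copy (group_ring gT) {ffun gT -> int}.

Section GroupRing.

Variable gT : finGroupType.
Implicit Types a b c : group_ring gT.

Definition gr_coef (a : group_ring gT) (g : gT) : int :=
  (a : {ffun gT -> int}) g.

Definition gr_elt (x : gT) : group_ring gT := [ffun g => (g == x)%:R].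

Definition gr_mul a b : group_ring gT :=
  [ffun g => \sum_(h : gT) gr_coef a h * gr_coef b (h^-1 * g)%g].

Lemma gr_coefP a b : (forall g, gr_coef a g = gr_coef b g) -> a = b.
Proof. by move=> ab; apply/ffunP. Qed.

Lemma gr_coefD a b g : gr_coef (a + b) g = gr_coef a g + gr_coef b g.
Proof. by rewrite /gr_coef ffunE. Qed.

Lemma gr_coef0 g : gr_coef (0 : group_ring gT) g = 0.
Proof. by rewrite /gr_coef ffunE. Qed.

Lemma gr_coefN a g : gr_coef (- a) g = - gr_coef a g.
Proof. by rewrite /gr_coef ffunE. Qed.

Lemma gr_coef_mul a b g :
  gr_coef (gr_mul a b) g = \sum_(h : gT) gr_coef a h * gr_coef b (h^-1 * g)%g.
Proof. by rewrite {1}/gr_coef ffunE. Qed.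

Lemma gr_coef_elt x g : gr_coef (gr_elt x) g = (g == x)%:R.
Proof. by rewrite /gr_coef ffunE. Qed.

Fact gr_mulA : associative gr_mul.
Proof.
move=> a b c; apply: gr_coefP => g; rewrite !gr_coef_mul.
under [RHS]eq_bigr do rewrite gr_coef_mul mulr_suml.
rewrite exchange_big /=; apply: eq_bigr => k _.
rewrite gr_coef_mul mulr_sumr [RHS](reindex_inj (mulgI k)) /=.
by apply: eq_bigr => h _; rewrite mulrA mulKg invMg mulgA.
Qed.

Fact gr_mul1l : left_id (gr_elt 1%g) gr_mul.
Proof.
move=> a; apply: gr_coefP => g; rewrite gr_coef_mul (bigD1 1%g) //= big1 => [|h].
  by rewrite gr_coef_elt eqxx mul1r addr0 invg1 mul1g.
by rewrite gr_coef_elt => /negPf ->; rewrite mul0r.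
Qed.

Fact gr_mul1r : right_id (gr_elt 1%g) gr_mul.
Proof.
move=> a; apply: gr_coefP => g; rewrite gr_coef_mul (bigD1 g) //= big1 => [|h hg].
  by rewrite gr_coef_elt mulVg eqxx mulr1 addr0.
by rewrite gr_coef_elt -eq_mulVg1 (negPf hg) mulr0.
Qed.

Fact gr_mulDl : left_distributive gr_mul +%R.
Proof.
move=> a b c; apply: gr_coefP => g.
rewrite gr_coefD !gr_coef_mul -big_split /=.
by apply: eq_bigr => h _; rewrite gr_coefD mulrDl.
Qed.

Fact gr_mulDr : right_distributive gr_mul +%R.
Proof.
move=> a b c; apply: gr_coefP => g.
rewrite gr_coefD !gr_coef_mul -big_split /=.
by apply: eq_bigr => h _; rewrite gr_coefD mulrDr.
Qed.

Fact gr_1neq0 : gr_elt 1%g != 0 :> group_ring gT.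
Proof.
apply/eqP => /(congr1 (gr_coef^~ 1%g)) /=.
by rewrite gr_coef_elt gr_coef0 eqxx.
Qed.

HB.instance Definition _ := GRing.Zmodule_isNzRing.Build (group_ring gT)
  gr_mulA gr_mul1l gr_mul1r gr_mulDl gr_mulDr gr_1neq0.

Lemma gr_coefM a b g :
  gr_coef (a * b) g = \sum_(h : gT) gr_coef a h * gr_coef b (h^-1 * g)%g.
Proof. exact: gr_coef_mul. Qed.

Lemma gr_coefMz a (m : int) g : gr_coef (a *~ m) g = gr_coef a g * m.
Proof.
have natE n : gr_coef (a *+ n) g = gr_coef a g *+ n.
  by elim: n => [|n IHn]; rewrite ?mulr0n ?gr_coef0 // !mulrS gr_coefD IHn.
case: m => n.
  by rewrite -pmulrn natE -mulrzz.
by rewrite NegzE !mulrNz gr_coefN -pmulrn natE mulrN -mulrzz.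
Qed.

Lemma gr_coef_sum (I : Type) (r : seq I) (P : pred I)
    (F : I -> group_ring gT) g :
  gr_coef (\sum_(i <- r | P i) F i) g = \sum_(i <- r | P i) gr_coef (F i) g.
Proof.
apply: (big_morph (gr_coef^~ g)) => [a b|]; [exact: gr_coefD | exact: gr_coef0].
Qed.

Definition set_sum (X : {set gT}) : group_ring gT := \sum_(x in X) gr_elt x.

Lemma gr_coef_set_sum X g : gr_coef (set_sum X) g = (g \in X)%:R.
Proof.
rewrite gr_coef_sum; under eq_bigr do rewrite gr_coef_elt.
have [gX|gX] := boolP (g \in X).
  rewrite (bigD1 g) //= eqxx big1 ?addr0 // => x /andP[_].
  by rewrite eq_sym => /negPf ->.
by rewrite big1 // => x xX; case: eqP => // gx; rewrite gx xX in gX.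
Qed.

End GroupRing.

Section SRing.

Variable gT : finGroupType.

(* A boolean predicate loses no generality as a subset of the group ring:
   membership in the span of a partition is decidable. *)
Record sring := SRing {
  sring_mem :> {pred group_ring gT};
  basic_sets : {set {set gT}};
  sring_subring : subring_closed sring_mem;
  basic_partition : partition basic_sets [set: gT];
  basic1 : [set 1%g] \in basic_sets;
  basicV : forall X : {set gT}, X \in basic_sets -> X^-1%g \in basic_sets;
  sring_span : forall a : group_ring gT,
    a \in sring_mem <->
    exists c : {set gT} -> int, a = \sum_(X in basic_sets) set_sum X *~ c X
}.

Variable A : sring.
Implicit Types X Y Z : {set gT}.

Lemma gr_coef_span (c : {set gT} -> int) Z g :
  Z \in basic_sets A -> g \in Z ->
  gr_coef (\sum_(X in basic_sets A) set_sum X *~ c X) g = c Z.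
Proof.
move=> ZS gZ; have /and3P[_ tiS _] := basic_partition A.
rewrite gr_coef_sum (bigD1 Z) //= gr_coefMz gr_coef_set_sum gZ mul1r.
rewrite big1 ?addr0 // => X /andP[XS XZ].
rewrite gr_coefMz gr_coef_set_sum; case gX: (g \in X); last by rewrite mul0r.
by case/eqP: XZ; rewrite -(def_pblock tiS XS gX) (def_pblock tiS ZS gZ).
Qed.

Lemma repr_basic Z : Z \in basic_sets A -> repr Z \in Z.
Proof.
move=> ZS; have /and3P[_ _ S0] := basic_partition A.
have /set0Pn[x xZ] : Z != set0 by apply: contraNneq S0 => <-.
exact: mem_repr xZ.
Qed.

(* The coefficient of the product at any element of Z; structure_constP and
   structure_const_uniq state that these are the structure constants. *)
Definition structure_const X Y Z : int :=
  gr_coef (set_sum X * set_sum Y) (repr Z).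

Lemma set_sum_sring X : X \in basic_sets A -> set_sum X \in sring_mem A.
Proof.
move=> XS; apply/sring_span; exists (fun Y => (Y == X)%:R).
rewrite (bigD1 X) //= eqxx big1 ?addr0 // => Y /andP[_ /negPf ->].
by rewrite mulr0z.
Qed.

Lemma structure_constP X Y :
  X \in basic_sets A -> Y \in basic_sets A ->
  set_sum X * set_sum Y
    = \sum_(Z in basic_sets A) set_sum Z *~ structure_const X Y Z.
Proof.
move=> XS YS; have [_ _ AM] := sring_subring A.
have /sring_span[c XYc] := AM _ _ (set_sum_sring XS) (set_sum_sring YS).
rewrite XYc; apply: eq_bigr => Z ZS; congr (_ *~ _).
by rewrite /structure_const XYc (gr_coef_span c ZS (repr_basic ZS)).
Qed.

Lemma structure_const_uniq X Y (c : {set gT} -> int) :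
  set_sum X * set_sum Y = \sum_(Z in basic_sets A) set_sum Z *~ c Z ->
  {in basic_sets A, forall Z, c Z = structure_const X Y Z}.
Proof.
move=> XYc Z ZS.
by rewrite /structure_const XYc (gr_coef_span c ZS (repr_basic ZS)).
Qed.

End SRing.

(* The partition is a field of sring, but it is determined by the subring. *)
Lemma basic_sets_uniq (gT : finGroupType) (A B : sring gT) :
  sring_mem A =i sring_mem B -> basic_sets A = basic_sets B.
Proof.
have sub (A1 A2 : sring gT) : sring_mem A1 =i sring_mem A2 ->
    forall X Y g, X \in basic_sets A1 -> Y \in basic_sets A2 ->
    g \in X -> g \in Y -> Y \subset X.
  move=> eqA X Y g XS YS gX gY; apply/subsetP => h hY.
  have := set_sum_sring XS; rewrite eqA => /sring_span[c Xc].
  have gE := gr_coef_set_sum X g; have hE := gr_coef_set_sum X h.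
  move: gE hE; rewrite Xc (gr_coef_span c YS gY) (gr_coef_span c YS hY) gX.
  by move=> ->; case: (h \in X).
have half (A1 A2 : sring gT) : sring_mem A1 =i sring_mem A2 ->
    basic_sets A1 \subset basic_sets A2.
  move=> eqA; apply/subsetP => X XS.
  have XX := repr_basic XS; set g := repr X in XX.
  have /and3P[/eqP cov _ _] := basic_partition A2.
  have: g \in cover (basic_sets A2) by rewrite cov inE.
  case/bigcupP => Y YS gY.
  suff -> : X = Y by [].
  apply/eqP; rewrite eqEsubset (sub A1 A2 eqA X Y g) //.
  by rewrite (sub A2 A1 _ Y X g) // => a; rewrite eqA.
by move=> eqAB; apply/eqP; rewrite eqEsubset !half // => a; rewrite eqAB.
Qed.

Definition Rel (gT : finGroupType) (X : {set gT}) : {set gT * gT} :=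
  [set (g, (x * g)%g) | x in X, g in [set: gT]].

Definition rel_image (gT gT' : finGroupType) (f : gT -> gT')
    (r : {set gT * gT}) : {set gT' * gT'} :=
  [set (f u.1, f u.2) | u in r].

(* Only the values of phi on the basic sets of A matter. *)
Definition algebraic_iso (gT gT' : finGroupType) (A : sring gT)
    (A' : sring gT') (phi : {set gT} -> {set gT'}) : Prop :=
  [/\ {in basic_sets A &, injective phi},
      phi @: basic_sets A = basic_sets A'
    & {in basic_sets A & &, forall X Y Z : {set gT},
        structure_const X Y Z = structure_const (phi X) (phi Y) (phi Z)}].

Definition combinatorial_iso (gT gT' : finGroupType) (A : sring gT)
    (A' : sring gT') (f : gT -> gT') : Prop :=
  bijective f /\
  [set rel_image f (Rel X) | X in basic_sets A]
    = [set Rel X' | X' in basic_sets A'].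

Definition induced_by (gT gT' : finGroupType) (A : sring gT)
    (phi : {set gT} -> {set gT'}) (f : gT -> gT') : Prop :=
  {in basic_sets A, forall X : {set gT},
    rel_image f (Rel X) = Rel (phi X)}.

Definition group_class := finGroupType -> Prop.

Definition abelian_groups : group_class := fun gT => abelian [set: gT].

Definition separable_sring (K : group_class) (gT : finGroupType)
    (A : sring gT) : Prop :=
  forall (gT' : finGroupType) (A' : sring gT') (phi : {set gT} -> {set gT'}),
    K gT' -> algebraic_iso A A' phi ->
    exists f : gT -> gT', combinatorial_iso A A' f /\ induced_by A phi f.

Definition separable_group (K : group_class) (gT : finGroupType) : Prop :=
  forall A : sring gT, separable_sring K A.

(* Main.v *)
From HB Require Import structures.
Require Import Defs.
From mathcomp Require Import all_boot all_order all_algebra all_fingroup.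
From mathcomp Require Import all_solvable zify.

Set Implicit Arguments.
Unset Strict Implicit.
Unset Printing Implicit Defensive.

Import GRing.Theory.
Local Open Scope group_scope.

(** Colour each group by its basic sets, transporting the colours of the first
group by the algebraic isomorphism. The algebraic isomorphism is then the
statement that the two colourings are linked: the number of factorizations of
an element into factors of two given colours depends on its colour only, in the
same way in both groups.

Case k = 1. If l is a prime with l = 1 mod p, then X^l and X agree modulo l in
the group ring of C_p^3, by Frobenius. Written with structure constants this
passes to the second group G', where it says that every basic set is stable
under x |-> x^l. Adding base-p digits with or without carries differs by such a
power map, so the digits of the elements of G' identify the S-ring over G' with
one over C_p^3. Over C_p^3 every algebraic isomorphism is induced by a linear
map. This is an exhaustive search: a partition, coarser than both colourings and
the same in both groups, is refined by intersection numbers and by guessing one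
basic set at a time; all the guesses with the same intersection numbers turn out
to be equivalent under the linear maps that preserve the partition.

Case k > 1. A non-separable S-ring over C_p x C_p x C_(p^2) is extended to the
whole group by one more basic set, the complement of this subgroup. For p = 2
the 4 x 4 rook graph is algebraically isomorphic to the Shrikhande graph, a
Cayley graph of C_4 x C_4 without 4-cliques. For p = 3, a split of the four lines
of C_3^2 into two pairs yields a split of C_3^2 \ {0} into two quadruples.
One split colours the elements (a, b, c) with c of order 3, a second one those
with c of order 9; the structure constants do not see whether both are the same. *)

(** * Linked colourings *)

Section Linked.
Variables (C : finType).

(** On the classes of an S-ring these are the structure constants, taken at a point; in this form
    they make sense for any colouring. *)
Definition npairs (gT : finGroupType) (col : gT -> C) i j z :=
  #|[set h | (col h == i) && (col (h^-1 * z) == j)]|.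

(* The colours of [gT'] are named after those of [gT], so that no bijection between
   the colours appears. *)
Record linked (gT gT' : finGroupType) (col : gT -> C) (col' : gT' -> C) : Prop := Linked {
  linked_l : forall g, exists g', col g = col' g';
  linked_r : forall g', exists g, col g = col' g';
  linked1 : forall g g', col g = col' g' -> (g == 1) = (g' == 1);
  linkedV : forall g g', col g = col' g' -> col g^-1 = col' g'^-1;
  linked_npairs : forall g g' i j, col g = col' g' ->
    npairs col i j g = npairs col' i j g'
}.

Variables (gT gT' : finGroupType) (col : gT -> C) (col' : gT' -> C).

Lemma linked_sym : linked col col' -> linked col' col.
Proof.
case=> Hl Hr H1 HV Hn; split=> [g|g|g g'|g g'|g g' i j] => [||/esym/H1->|/esym/HV->|/esym/Hn->] //.
  by have [x] := Hr g; exists x.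
by have [x] := Hl g; exists x.
Qed.

Lemma linked_self : linked col col' -> linked col col.
Proof.
case=> Hl Hr H1 HV Hn; split=> [g|g|g h gh|g h gh|g h i j gh]; first by exists g.
- by exists g.
- by have [g' gg'] := Hl g; rewrite (H1 _ _ gg') -(H1 h g') // -gh.
- by have [g' gg'] := Hl g; rewrite (HV _ _ gg') -(HV h g') // -gh.
by have [g' gg'] := Hl g; rewrite (Hn _ _ _ _ gg') -(Hn h g') // -gh.
Qed.

Lemma sum_npairsr i z : \sum_j npairs col i j z = #|[set h | col h == i]|.
Proof.
rewrite -sum1dep_card (partition_big (fun h => col (h^-1 * z)) predT) //=.
by apply: eq_bigr => j _; rewrite /npairs -sum1dep_card.
Qed.

Lemma sum_npairsl j z : \sum_i npairs col i j z = #|[set h | col h == j]|.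
Proof.
rewrite -sum1dep_card (reindex_inj (inj_comp (mulIg z) invg_inj)) /=.
rewrite (partition_big col predT) //=; apply: eq_bigr => i _.
by rewrite /npairs -sum1dep_card; apply: eq_bigl => h /=; rewrite andbC.
Qed.

Lemma sum_card_classes : \sum_i #|[set h | col h == i]| = #|gT|.
Proof.
rewrite -sum1_card (partition_big col predT) //=.
by apply: eq_bigr => i _; rewrite -sum1dep_card.
Qed.
End Linked.

(** A class size is a sum of intersection numbers at any single point. *)
Lemma linked_card_class (C : finType) (gT gT' : finGroupType) (col : gT -> C) (col' : gT' -> C) i :
  linked col col' -> #|[set h | col h == i]| = #|[set h | col' h == i]|.
Proof.
move=> L; have [g' e] := linked_l L 1.
rewrite -(sum_npairsr _ _ 1) -(sum_npairsr _ _ g').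
by apply: eq_bigr => j _; rewrite (linked_npairs L _ _ e).
Qed.

Lemma linked_card (C : finType) (gT gT' : finGroupType) (col : gT -> C) (col' : gT' -> C) :
  linked col col' -> #|gT| = #|gT'|.
Proof.
move=> L; rewrite -(sum_card_classes col) -(sum_card_classes col').
by apply: eq_bigr => i _; exact: linked_card_class.
Qed.

Lemma card_npairs (C : finType) (gT : finGroupType) (col : gT -> C) (P Q : pred C) z :
  #|[set h | P (col h) && Q (col (h^-1 * z))]| = \sum_(a | P a) \sum_(b | Q b) npairs col a b z.
Proof.
rewrite -sum1dep_card (partition_big col P) => [|h /andP[]//] /=.
apply: eq_bigr => a Pa.
rewrite (partition_big (fun h => col (h^-1 * z)) Q) => [|h /andP[/andP[]]//] /=.
apply: eq_bigr => b Qb; rewrite /npairs -sum1dep_card; apply: eq_bigl => h.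
case: (col h =P a) => [->|]; last by rewrite andbF.
by case: (col (h^-1 * z) =P b) => [->|]; rewrite ?andbF // Pa Qb.
Qed.

Lemma npairs_map (C D : finType) (F : C -> D) (gT : finGroupType) (col : gT -> C) i j z :
  npairs (F \o col) i j z = \sum_(a | F a == i) \sum_(b | F b == j) npairs col a b z.
Proof. exact: card_npairs. Qed.

(** * Algebraic isomorphisms of S-rings as linked colourings *)

Section SRingColour.
Variables (gT : finGroupType) (A : sring gT).
Local Notation S := (basic_sets A).

Definition colour g := pblock S g.

Lemma cover_basic g : g \in cover S.
Proof. by have /and3P[/eqP-> _ _] := basic_partition A; rewrite inE. Qed.

Lemma mem_colour g : g \in colour g.
Proof. by rewrite mem_pblock cover_basic. Qed.

Lemma colour_basic g : colour g \in S.
Proof. by rewrite pblock_mem ?cover_basic. Qed.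

Lemma colourP X g : X \in S -> (g \in X) = (colour g == X).
Proof.
move=> XS; have /and3P[_ tiS _] := basic_partition A.
by apply/idP/eqP => [/(def_pblock tiS XS)//|<-]; exact: mem_colour.
Qed.

Lemma structure_constE X Y g : X \in S -> Y \in S ->
  structure_const X Y (colour g) = Posz (npairs colour X Y g).
Proof.
move=> XS YS.
have <- : gr_coef (set_sum X * set_sum Y)%R g = structure_const X Y (colour g).
  by rewrite (structure_constP XS YS) (gr_coef_span _ (colour_basic g) (mem_colour g)).
rewrite -natz gr_coefM /npairs -sum1dep_card natr_sum (big_mkcond (fun h => (_ && _))) /=.
apply: eq_bigr => h _; rewrite !gr_coef_set_sum (colourP _ XS) (colourP _ YS).
by do 2!case: eqP.
Qed.

End SRingColour.

Section AlgIso.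
Variables (gT gT' : finGroupType) (A : sring gT) (A' : sring gT').
Variable phi : {set gT} -> {set gT'}.
Hypothesis phiA : algebraic_iso A A' phi.

Let col g := phi (colour A g).
Let col' := colour A'.

Let phi_basic X : X \in basic_sets A -> phi X \in basic_sets A'.
Proof. by case: phiA => _ <- _ XS; exact: imset_f. Qed.

Let phi_onto g' : exists2 X, X \in basic_sets A & phi X = col' g'.
Proof.
by have := colour_basic A' g'; case: phiA => _ <- _ /imsetP[X XS]; exists X.
Qed.

Let npairs_phi X Y g : X \in basic_sets A -> Y \in basic_sets A ->
  npairs col (phi X) (phi Y) g = npairs (colour A) X Y g.
Proof.
move=> XS YS; case: phiA => inj _ _; rewrite /npairs; congr #|pred_of_set _|.
by apply/setP=> h; rewrite !inE /col !(inj_in_eq inj) ?colour_basic.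
Qed.

Let npairs_link g g' i j : col g = col' g' -> npairs col i j g = npairs col' i j g'.
Proof.
move=> gg'.
(* A colour that is not a basic set is taken by no element, so both counts vanish. *)
have [iS'|/negP iS'] := boolP (i \in basic_sets A'); last first.
  rewrite /npairs; transitivity 0; last symmetry; apply/eqP; rewrite cards_eq0 -subset0;
    apply/subsetP => h; rewrite inE => /andP[/eqP e _]; case: iS'; rewrite -e;
    rewrite ?phi_basic ?colour_basic //.
have [jS'|/negP jS'] := boolP (j \in basic_sets A'); last first.
  rewrite /npairs; transitivity 0; last symmetry; apply/eqP; rewrite cards_eq0 -subset0;
    apply/subsetP => h; rewrite inE => /andP[_ /eqP e]; case: jS'; rewrite -e;
    rewrite ?phi_basic ?colour_basic //.
case: (phiA) => _ im sc; move: iS' jS'; rewrite -im.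
case/imsetP=> X XS -> /imsetP[Y YS ->]; rewrite npairs_phi //.
apply/eqP; rewrite -eqz_nat -structure_constE // sc ?colour_basic //.
by rewrite [phi (colour A g)]gg' structure_constE // -im imset_f.
Qed.

(** For [z'] in the image of the class of 1, the factorization [z' = z' * 1] is counted by a
    positive structure constant. Transported back to the identity, it forces the class mapped to the
    class of 1 to contain 1. *)
Let phi1 : phi [set 1] = [set 1].
Proof.
have [X XS X1] := phi_onto 1; have e1 := colourP _ (basic1 A').
have c1 : col' 1 = [set 1] by apply/eqP; rewrite -e1 set11.
have S1 := basic1 A; rewrite c1 in X1.
have /set0Pn[z' zE] : phi [set 1] != set0.
  by have /and3P[_ _] := basic_partition A'; apply: contraNneq => <-; exact: phi_basic.
have z'E : col' z' = phi [set 1] by apply/eqP; rewrite -(colourP _ (phi_basic S1)).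
have cA1 : colour A 1 = [set 1] by apply/eqP; rewrite -(colourP _ S1) set11.
have : 0 < npairs col' (phi [set 1]) [set 1] z'.
  by apply/card_gt0P; exists z'; rewrite inE z'E eqxx mulVg c1 eqxx.
rewrite -(@npairs_link 1) ?z'E /col ?cA1 // -X1 npairs_phi //.
case/card_gt0P => h; rewrite inE -(colourP _ S1) => /andP[/set1P-> ].
by rewrite invg1 mulg1 cA1 => /eqP ->.
Qed.

Lemma alg_iso_linked : linked col col'.
Proof.
have cA1 : colour A 1 = [set 1] by apply/eqP; rewrite -(colourP _ (basic1 A)) set11.
have cA'1 : col' 1 = [set 1] by apply/eqP; rewrite -(colourP _ (basic1 A')) set11.
case: (phiA) => inj im _.
have l1 g g' : col g = col' g' -> (g == 1) = (g' == 1).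
  move=> gg'; transitivity (g' \in [set 1]); last by rewrite inE.
  transitivity (g \in [set 1]); first by rewrite inE.
  rewrite (colourP _ (basic1 A)) (colourP _ (basic1 A')) -/col' -gg'.
  by rewrite -[in RHS]phi1 (inj_in_eq inj) ?colour_basic ?basic1.
have cV (hT : finGroupType) (B : sring hT) x : colour B x^-1 = (colour B x)^-1%g.
  apply/eqP; rewrite -colourP; last exact/basicV/colour_basic.
  by rewrite memV_invg mem_colour.
split=> //.
- move=> g; have Xg := phi_basic (colour_basic A g).
  have /set0Pn[g' g'X] : col g != set0.
    by have /and3P[_ _] := basic_partition A'; apply: contraNneq => <-.
  by exists g'; apply/esym/eqP; rewrite -colourP.
- move=> g'; have [X XS Xg'] := phi_onto g'.
  have Xg := repr_basic XS; exists (repr X); rewrite -Xg' /col.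
  by congr phi; apply/eqP; rewrite -colourP.
move=> g g' gg'; have gV : colour A g^-1 \in basic_sets A by exact: colour_basic.
(* The inverse class is recognized by a positive structure constant at the identity. *)
have: 0 < npairs col (col g) (col g^-1) 1.
  by apply/card_gt0P; exists g; rewrite inE mulg1 !eqxx.
rewrite (@npairs_link _ 1) => [|]; last by rewrite /col cA1 phi1.
case/card_gt0P => h; rewrite inE mulg1 gg' => /andP[/eqP hg' /eqP <-].
by rewrite /col' !cV -/col' hg'.
Qed.

(** [Rel X] consists of the pairs [(x, y)] with [y * x^-1] in [X], so [f] only has to respect the
    colours of these quotients. *)
Lemma colour_iso_induced (f : gT -> gT') : bijective f ->
  (forall x y, col' (f y * (f x)^-1) = col (y * x^-1)) ->
  combinatorial_iso A A' f /\ induced_by A phi f.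
Proof.
move=> bijf fcol; case: (phiA) => inj im _.
have ind : induced_by A phi f.
  move=> X XS; case: bijf => f' fK f'K.
  have memR (hT : finGroupType) (Y : {set hT}) u : (u \in Rel Y) = (u.2 * u.1^-1 \in Y).
    case: u => a b /=; apply/imset2P/idP => [[x g xY _ [-> ->]]|abY]; first by rewrite mulgK.
    by exists (b * a^-1) a; rewrite ?inE // mulgKV.
  apply/setP=> -[a b]; rewrite memR /=.
  apply/imsetP/idP => [[[x y]]|abX].
    rewrite memR /= (colourP _ XS) => /eqP xyX [-> ->].
    by rewrite (colourP _ (phi_basic XS)) -/col' fcol /col xyX.
  exists (f' a, f' b); rewrite /= ?f'K // memR /= (colourP _ XS).
  rewrite -(inj_in_eq inj) ?colour_basic // -[phi (colour _ _)]/(col _) -fcol !f'K.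
  by rewrite -(colourP _ (phi_basic XS)).
split=> //; split=> //; rewrite -im -imset_comp.
by apply: eq_in_imset => X XS /=; exact: ind.
Qed.

End AlgIso.

(** * From linked colourings back to S-rings *)

Section SRingOfColouring.
Variables (C : finType) (gT : finGroupType) (col : gT -> C).
Hypothesis colL : linked col col.

Definition col_class g := [set h | col h == col g].
Definition col_classes := [set col_class g | g in [set: gT]].

Definition constant_on_classes : {pred group_ring gT} :=
  fun a => [forall x, forall y, (col x == col y) ==> (gr_coef a x == gr_coef a y)].

Lemma constant_on_classesP a :
  reflect (forall x y, col x = col y -> gr_coef a x = gr_coef a y)
          (a \in constant_on_classes).
Proof.
apply: (iffP forallP) => [h x y xy|h x].
  by have /forallP/(_ y)/implyP/(_ (introT eqP xy))/eqP := h x.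
by apply/forallP => y; apply/implyP => /eqP /h ->.
Qed.

Lemma gr_coefM_class a (i : C) (alpha : C -> int) (X : {set gT}) z :
  (forall h, (h \in X) = (col h == i)) -> (forall h, gr_coef a h = alpha (col h)) ->
  gr_coef (set_sum X * a)%R z = (\sum_j alpha j *+ npairs col i j z)%R.
Proof.
move=> Xi aE; rewrite gr_coefM.
rewrite (bigID (fun h => h \in X)) /= addrC big1 ?add0r => [|h /negPf hX]; last first.
  by rewrite gr_coef_set_sum hX mul0r.
rewrite (partition_big (fun h => col (h^-1 * z)) predT) //=.
apply: eq_bigr => j _; rewrite /npairs -sum1dep_card -sumrMnr.
rewrite (eq_bigl (fun h => (col h == i) && (col (h^-1 * z) == j))) => [|h]; last by rewrite Xi.
by apply: eq_bigr => h /andP[hi /eqP hj]; rewrite gr_coef_set_sum Xi hi mul1r aE hj.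
Qed.

Lemma gr_coefM_npairs a b z (alpha beta : C -> int) :
  (forall h, gr_coef a h = alpha (col h)) -> (forall h, gr_coef b h = beta (col h)) ->
  gr_coef (a * b)%R z = (\sum_i \sum_j (alpha i * beta j) *+ npairs col i j z)%R.
Proof.
move=> aE bE; rewrite gr_coefM (partition_big col predT) //=.
apply: eq_bigr => i _; rewrite (partition_big (fun h => col (h^-1 * z)) predT) //=.
apply: eq_bigr => j _; rewrite /npairs -sum1dep_card -sumrMnr.
by apply: eq_bigr => h /andP[/eqP <- /eqP <-]; rewrite aE bE.
Qed.

Lemma constant_on_classesE a : a \in constant_on_classes ->
  exists alpha : C -> int, forall h, gr_coef a h = alpha (col h).
Proof.
move/constant_on_classesP => ca.
exists (fun i => odflt 0%R (omap (gr_coef a) [pick h | col h == i])) => h.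
by case: pickP => [x /eqP /= xh|/(_ h)]; rewrite ?eqxx //; exact/ca.
Qed.

(** A coefficient of a product is a combination of intersection numbers, which depend only on the
    colour of the point. *)
Fact constant_on_classes_subring : subring_closed constant_on_classes.
Proof.
split=> [|a b|a b].
- apply/constant_on_classesP => x y xy.
  by rewrite !gr_coef_elt (linked1 colL xy).
- move=> /constant_on_classesP ca /constant_on_classesP cb.
  by apply/constant_on_classesP => x y xy; rewrite !gr_coefD !gr_coefN (ca x y) // (cb x y).
move=> /constant_on_classesE[al alE] /constant_on_classesE[be beE].
apply/constant_on_classesP => x y xy; rewrite !(gr_coefM_npairs _ alE beE).
by apply: eq_bigr => i _; apply: eq_bigr => j _; rewrite (linked_npairs colL _ _ xy).
Qed.

Lemma mem_col_class g : g \in col_class g. Proof. by rewrite inE. Qed.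

Lemma col_class_eq g h : (h \in col_class g) -> col_class h = col_class g.
Proof. by rewrite inE => /eqP hg; apply/setP=> x; rewrite !inE hg. Qed.

Lemma col_class_basic g : col_class g \in col_classes.
Proof. by rewrite imset_f. Qed.

Fact col_classes_partition : partition col_classes [set: gT].
Proof.
apply/and3P; split.
- apply/eqP/setP=> g; rewrite inE; apply/bigcupP; exists (col_class g) => //.
    exact: col_class_basic.
  exact: mem_col_class.
- apply/trivIsetP => _ _ /imsetP[g _ ->] /imsetP[h _ ->] gh.
  rewrite -setI_eq0; apply: contraNT gh => /set0Pn[x /setIP[xg xh]].
  by rewrite -(col_class_eq xg) (col_class_eq xh).
by apply/imsetP => -[g _ /setP/(_ g)]; rewrite mem_col_class inE.
Qed.

Fact col_classes1 : [set 1] \in col_classes.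
Proof.
rewrite (_ : [set 1] = col_class 1) ?col_class_basic //.
apply/setP=> x; rewrite !inE; apply/eqP/eqP => [->//|x1].
by apply/eqP; rewrite (linked1 colL x1).
Qed.

Fact col_classesV (X : {set gT}) : X \in col_classes -> X^-1%g \in col_classes.
Proof.
case/imsetP=> g _ ->; rewrite (_ : _^-1 = col_class g^-1) ?col_class_basic //.
apply/setP=> x; rewrite !inE; apply/eqP/eqP => [/(linkedV colL)|/(linkedV colL)].
  by rewrite invgK.
by rewrite invgK.
Qed.

Fact constant_on_classes_span a :
  a \in constant_on_classes <->
  exists c : {set gT} -> int, a = (\sum_(X in col_classes) set_sum X *~ c X)%R.
Proof.
have sumE c x : gr_coef (\sum_(X in col_classes) set_sum X *~ c X)%R x = c (col_class x).
  rewrite gr_coef_sum (bigD1 _ (col_class_basic x)) /= gr_coefMz gr_coef_set_sum mem_col_class.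
  rewrite mul1r big1 ?addr0 // => X /andP[/imsetP[g _ ->] neq].
  rewrite gr_coefMz gr_coef_set_sum; case xg: (x \in _); last by rewrite mul0r.
  by rewrite (col_class_eq xg) eqxx in neq.
split=> [/constant_on_classesP ca|[c ->]].
  exists (fun X => gr_coef a (repr X)); apply: gr_coefP => x; rewrite sumE.
  by apply: ca; have /(mem_repr x) := mem_col_class x; rewrite inE => /eqP.
apply/constant_on_classesP => x y xy; rewrite !sumE.
by congr c; apply/setP=> z; rewrite !inE xy.
Qed.

Definition col_sring := SRing constant_on_classes_subring col_classes_partition
  col_classes1 col_classesV constant_on_classes_span.

Lemma colour_col_sring g : colour col_sring g = col_class g.
Proof. by apply/eqP; rewrite -colourP ?mem_col_class //; exact: col_class_basic. Qed.

Lemma structure_const_col_sring x y z :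
  structure_const (col_class x) (col_class y) (col_class z)
    = Posz (npairs col (col x) (col y) z).
Proof.
rewrite -{1}(colour_col_sring z) structure_constE; try exact: col_class_basic.
congr (Posz #|pred_of_set _|); apply/setP=> h; rewrite !inE !colour_col_sring.
have E u v : (col_class u == col_class v) = (col u == col v).
  apply/eqP/eqP => [uv|uv]; first by have := mem_col_class u; rewrite uv inE => /eqP.
  by apply/setP=> w; rewrite !inE uv.
by rewrite !E.
Qed.

End SRingOfColouring.

(** A linked pair yields two S-rings with an algebraic isomorphism between them; a bijection
    inducing it would respect the colours of quotients. *)
Lemma not_separable_of_linked (C : finType) (K : group_class) (gT gT' : finGroupType)
    (col : gT -> C) (col' : gT' -> C) :
  linked col col' -> K gT' ->
  (forall f : gT -> gT', bijective f ->
     ~ (forall x y, col' (f y * (f x)^-1) = col (y * x^-1))) ->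
  ~ separable_group K gT.
Proof.
move=> L KG' nof sepG.
have L1 := linked_self L; have L2 := linked_self (linked_sym L).
(* A class goes to the class of the same colour, read off at a representative. *)
pose phi X := [set g' | col' g' == col (repr X)].
have phiE g g' : col g = col' g' -> phi (col_class col g) = col_class col' g'.
  move=> gg'; apply/setP=> x; rewrite !inE -gg'.
  by have /(mem_repr g) := mem_col_class col g; rewrite inE => /eqP ->.
have phiA : algebraic_iso (col_sring L1) (col_sring L2) phi.
  split.
  - move=> _ _ /imsetP[x _ ->] /imsetP[y _ ->].
    have [x' xx'] := linked_l L x; have [y' yy'] := linked_l L y.
    rewrite (phiE _ _ xx') (phiE _ _ yy') => /setP/(_ x').
    rewrite mem_col_class inE -xx' -yy' => /esym/eqP xy.
    by apply/setP=> z; rewrite !inE xy.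
  - apply/setP=> X; apply/imsetP/imsetP => [[_ /imsetP[x _ ->] ->]|[x' _ ->]].
      by have [x' xx'] := linked_l L x; exists x'; rewrite ?inE // (phiE _ _ xx').
    have [x xx'] := linked_r L x'; exists (col_class col x); last by rewrite (phiE _ _ xx').
    exact: col_class_basic.
  move=> _ _ _ /imsetP[x _ ->] /imsetP[y _ ->] /imsetP[z _ ->].
  have [x' xx'] := linked_l L x; have [y' yy'] := linked_l L y; have [z' zz'] := linked_l L z.
  rewrite (phiE _ _ xx') (phiE _ _ yy') (phiE _ _ zz').
  rewrite (structure_const_col_sring L1) (structure_const_col_sring L2) xx' yy'.
  by rewrite (linked_npairs L _ _ zz').
have [f [[bijf _] ind]] := sepG _ _ _ _ KG' phiA.
apply: (nof f bijf) => x y.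
have [z' zz'] := linked_l L (y * x^-1).
have /setP/(_ (f x, f y)) := ind _ (col_class_basic col (y * x^-1)).
rewrite (phiE _ _ zz').
have -> : (f x, f y) \in rel_image f (Rel (col_class col (y * x^-1))).
  apply/imsetP; exists (x, y) => //; apply/imset2P.
  by exists (y * x^-1) x; rewrite ?mem_col_class ?inE // mulgKV.
move/esym/imset2P => [w v]; rewrite inE => /eqP wz _ [-> ->].
by rewrite mulgK wz zz'.
Qed.

(** * Multipliers and codings *)

(** The inner binomial coefficients of a prime row are divisible by [l]. *)
Lemma exprDn_prime_comm (R : nzRingType) (a b : R) l : prime l -> GRing.comm a b ->
  exists r, ((a + b) ^+ l = a ^+ l + b ^+ l + r *+ l)%R.
Proof.
move=> pl ab; case: l pl => // m pm.
exists (\sum_(i < m) (a ^+ (m.+1 - i.+1) * b ^+ i.+1) *+ ('C(m.+1, i.+1) %/ m.+1))%R.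
rewrite exprDn_comm // big_ord_recl big_ord_recr /= /bump !add1n bin0 binn !mulr1n.
rewrite subn0 subnn !expr0 mulr1 mul1r addrAC addrA; congr (_ + _)%R; congr (_ + _)%R.
rewrite -sumrMnl; apply: eq_bigr => i _; rewrite /bump /= add1n -mulrnA divnK //.
by apply: prime_dvd_bin => //=; rewrite ltnS ltn_ord.
Qed.

Section GroupRingAbelian.
Variable gT : finGroupType.
Hypothesis abG : abelian [set: gT].

Lemma abelian_mulgC (x y : gT) : x * y = y * x.
Proof. by apply: (centsP abG); rewrite inE. Qed.

Lemma gr_comm (a b : group_ring gT) : GRing.comm a b.
Proof.
apply: gr_coefP => g; rewrite !gr_coefM.
rewrite (reindex_inj (inj_comp (mulIg g) invg_inj)) /=.
by apply: eq_bigr => h _; rewrite invMg invgK -mulgA [h * g]abelian_mulgC mulKg mulrC.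
Qed.

Lemma gr_eltX (x : gT) n : (gr_elt x ^+ n)%R = gr_elt (x ^+ n).
Proof.
elim: n => [|n IHn]; first by rewrite expr0.
rewrite exprS IHn expgS; apply: gr_coefP => g.
rewrite gr_coefM (bigD1 x) //= big1 => [|h /negPf hx]; last by rewrite gr_coef_elt hx mul0r.
by rewrite !gr_coef_elt eqxx mul1r addr0 -(inj_eq (mulgI x)) mulKVg.
Qed.

(** Frobenius modulo [l], by induction on the elements of [X]. *)
Lemma set_sumX_prime (X : {set gT}) l : prime l ->
  exists r, (set_sum X ^+ l = \sum_(x in X) gr_elt (x ^+ l) + r *+ l)%R.
Proof.
move=> pl; rewrite /set_sum -!big_enum /=; elim: (enum X) => [|x s [r IHs]].
  by exists 0%R; rewrite !big_nil expr0n mul0rn addr0; case: l pl.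
have [r' E] := exprDn_prime_comm pl (gr_comm (gr_elt x) (\sum_(x <- s) gr_elt x)%R).
by exists (r + r')%R; rewrite !big_cons E IHs gr_eltX mulrnDl !addrA.
Qed.

End GroupRingAbelian.

(** By induction on [n], both coefficients are the same expression in the intersection numbers. *)
Lemma linked_coefX (C : finType) (gT gT' : finGroupType) (col : gT -> C) (col' : gT' -> C)
    (i : C) n z z' : linked col col' -> col z = col' z' ->
  gr_coef (set_sum [set x | col x == i] ^+ n)%R z
    = gr_coef (set_sum [set x | col' x == i] ^+ n)%R z'.
Proof.
move=> L; elim: n z z' => [|n IHn] z z' zz'.
  by rewrite !expr0 !gr_coef_elt (linked1 L zz').
set e := set_sum _ in IHn *; set e' := set_sum _ in IHn *.
(* The coefficient as a function of the colour; the default 1 is reached only at colours that no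
   element of [gT] has. *)
pose al c := gr_coef (e ^+ n)%R (odflt 1 [pick x | col x == c]).
have E' h' : gr_coef (e' ^+ n)%R h' = al (col' h').
  rewrite /al; case: pickP => [y /eqP /IHn->//|none].
  by have [y yh'] := linked_r L h'; have := none y; rewrite yh' eqxx.
have E h : gr_coef (e ^+ n)%R h = al (col h).
  by have [h' hh'] := linked_l L h; rewrite (IHn _ _ hh') E' hh'.
rewrite !exprS (gr_coefM_class (i := i) _ _ E) => [|h]; last by rewrite inE.
rewrite (gr_coefM_class (i := i) _ _ E') => [|h]; last by rewrite inE.
by apply: eq_bigr => j _; rewrite (linked_npairs L _ _ zz').
Qed.

(* For [i := col' g'], the number of [x] of colour [i] with [x ^+ l = g' ^+ l] is 1; modulo
   [l] it is a coefficient of a power of a class, hence the same as in [gT]. *)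
Lemma linked_expg (C : finType) (gT gT' : finGroupType) (col : gT -> C) (col' : gT' -> C) l g' :
  abelian [set: gT] -> abelian [set: gT'] -> linked col col' ->
  prime l -> coprime l #|gT'| -> (forall x : gT, x ^+ l = x) -> col' (g' ^+ l) = col' g'.
Proof.
move=> abG abG' L pl co expG.
have [z zg'] := linked_r L (g' ^+ l); set i := col' g'.
have := linked_coefX i l L zg'.
have [r ->] := set_sumX_prime abG [set x | col x == i] pl.
have [r' ->] := set_sumX_prime abG' [set x | col' x == i] pl.
rewrite !gr_coefD !gr_coef_sum.
have -> : (\sum_(x in [set x | col x == i]) gr_coef (gr_elt (x ^+ l)) z = (col z == i)%:R)%R.
  under eq_bigr do rewrite expG.
  by rewrite -gr_coef_sum gr_coef_set_sum inE.
have -> : (\sum_(x in [set x | col' x == i]) gr_coef (gr_elt (x ^+ l)) (g' ^+ l) = 1)%R.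
  rewrite (bigD1 g') ?inE //= gr_coef_elt eqxx big1 ?addr0 // => x /andP[_ xg'].
  rewrite gr_coef_elt; case: eqP => // /esym /=.
  have co' : coprime #|[set: gT']| l by rewrite cardsT coprime_sym.
  move/(can_in_inj (expgK co') (in_setT _) (in_setT _)) => gx.
  by rewrite gx eqxx in xg'.
have [/eqP|_] := boolP (col z == i); first by rewrite zg'.
rewrite !pmulrn !gr_coefMz add0r => /eqP; rewrite -subr_eq -mulrBl => /eqP e.
have : (l %| 1%R)%Z by rewrite -e dvdz_mull.
by rewrite dvdzE /= dvdn1 => /eqP l1; rewrite l1 in pl.
Qed.

(** Trivial factors pad the cyclic decomposition to three generators, so that the three isomorphism
    types can be treated alike. *)
Lemma abelian_p3_generators p (gT : finGroupType) :
  prime p -> abelian [set: gT] -> #|gT| = (p ^ 3)%N ->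
  exists u v w : gT, (forall g, exists i j k,
      [/\ i < #[u], j < #[v], k < #[w] & g = u ^+ i * v ^+ j * w ^+ k]) /\
    (#[u], #[v], #[w]) \in [:: (p ^ 3, 1, 1); (p ^ 2, p, 1); (p, p, p)]%N.
Proof.
move=> pp abG cG; have [b defG bt] := abelian_structure abG.
have := bigdprod_card defG; rewrite cardsT cG.
have -> : (\prod_(x <- b) #|<[x]>| = \prod_(n <- map order b) n)%N by rewrite big_map.
rewrite bt => prodt; have srt := abelian_type_dvdn_sorted [set: gT].
have gt1 := abelian_type_gt1 [set: gT].
have pw n : n \in abelian_type [set: gT] -> exists2 a, 0 < a & n = (p ^ a)%N.
  move=> nt; have : n %| (p ^ 3)%N by rewrite -prodt (big_rem n) //= dvdn_mulr.
  case/dvdn_pfactor => // a _ en; exists a => //.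
  by have /allP/(_ n nt) := gt1; rewrite /= en; case: a {en}.
have gen3 (u v w : gT) : [set: gT] = <[u]> * (<[v]> * <[w]>) -> forall g, exists i j k,
    [/\ i < #[u], j < #[v], k < #[w] & g = u ^+ i * v ^+ j * w ^+ k].
  move=> G3 g; have : g \in <[u]> * (<[v]> * <[w]>) by rewrite -G3 inE.
  case/mulsgP => _ _ /cyclePmin[i iu ->] /mulsgP[_ _ /cyclePmin[j jv ->] /cyclePmin[k kw ->] ->] ->.
  by exists i, j, k; rewrite mulgA.
have p1 := prime_gt1 pp; have pI := expnI p1.
move: (bigdprodW defG) prodt srt pw; rewrite -bt {defG bt gt1}.
case: b => [|u [|v [|w [|x b]]]] /=; rewrite ?big_cons ?big_nil ?muln1 ?mulg1 => G3 prodt srt pw.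
- by move: p1; rewrite -(ltn_exp2r _ _ (isT : 0 < 3)) -prodt exp1n.
- exists u, 1, 1; split; first by apply: gen3; rewrite !cycle1 !mulg1.
  by rewrite !order1 prodt inE eqxx.
- exists u, v, 1; split; first by apply: gen3; rewrite cycle1 mulg1.
  have [a a0 ea] := pw #[u] (mem_head _ _).
  have [c c0 ec] : exists2 a, 0 < a & #[v] = (p ^ a)%N by apply: pw; rewrite !inE eqxx orbT.
  move: prodt srt; rewrite order1 ea ec -expnD andbT dvdn_Pexp2l // => /pI ac ca.
  have [-> ->] : a = 2 /\ c = 1%N by lia.
  by rewrite !inE eqxx orbT.
- exists u, v, w; split; first exact: gen3.
  have [a a0 ea] := pw #[u] (mem_head _ _).
  have [c c0 ec] : exists2 a, 0 < a & #[v] = (p ^ a)%N by apply: pw; rewrite !inE eqxx orbT.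
  have [d d0 ed] : exists2 a, 0 < a & #[w] = (p ^ a)%N by apply: pw; rewrite !inE eqxx !orbT.
  move: prodt; rewrite ea ec ed -!expnD => /pI acd.
  have [-> -> ->] : [/\ a = 1, c = 1 & d = 1]%N by split; lia.
  by rewrite !inE eqxx !orbT.
(* Four non-trivial cyclic factors would make the order at least p^4. *)
have [a a0 ea] := pw #[u] (mem_head _ _).
have [c c0 ec] : exists2 a, 0 < a & #[v] = (p ^ a)%N by apply: pw; rewrite !inE eqxx orbT.
have [d d0 ed] : exists2 a, 0 < a & #[w] = (p ^ a)%N by apply: pw; rewrite !inE eqxx !orbT.
have [e e0 ee] : exists2 a, 0 < a & #[x] = (p ^ a)%N by apply: pw; rewrite !inE eqxx !orbT.
have r0 : 0 < \prod_(n <- map order b) n.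
  by rewrite big_map prodn_cond_gt0 // => y _; exact: order_gt0.
have : p ^ (a + (c + (d + e))) <= p ^ 3.
  by rewrite -prodt ea ec ed ee !expnD !mulnA leq_pmulr.
by rewrite leq_exp2l //; lia.
Qed.

(* [dec] need not be a morphism, only up to colours. *)
Definition coding (C : eqType) (T gT : finGroupType) (col : gT -> C) (dec : T -> gT) :=
  bijective dec /\ forall x y, col (dec (x * y^-1)) = col (dec x * (dec y)^-1).

(** After commuting the factors, [h^-1 * z] is a quotient, whose decoded colour is that of the
    quotient of the decoded elements; so decoding preserves all counts. *)
Lemma linked_coding (C : finType) (T gT gT' : finGroupType) (col : gT -> C) (col' : gT' -> C)
    (dec : T -> gT) (dec' : T -> gT') :
  abelian [set: T] -> abelian [set: gT] -> abelian [set: gT'] ->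
  linked col col' -> coding col dec -> coding col' dec' ->
  linked (col \o dec) (col' \o dec').
Proof.
move=> abT abG abG' L.
have code1 (hT : finGroupType) (f : hT -> C) (d : T -> hT) : linked f f -> coding f d ->
    [/\ d 1 = 1, forall x, f (d x^-1) = f (d x)^-1 &
        forall i j z, abelian [set: hT] -> npairs (f \o d) i j z = npairs f i j (d z)].
  move=> Lf [[d' dK d'K] fd].
  have d1 : d 1 = 1.
    have := fd 1 1; rewrite !mulgV => /(linked1 Lf).
    by rewrite eqxx => /eqP.
  split=> // [x|i j z abH]; first by have := fd 1 x; rewrite d1 !mul1g.
  rewrite /npairs -[RHS](on_card_preimset (f := d)); last first.
    by exists d' => ? _; rewrite ?dK ?d'K.
  congr #|pred_of_set _|; apply/setP=> h; rewrite !inE /=.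
  by rewrite abelian_mulgC // fd (abelian_mulgC abH).
move=> cd cd'; have [d1 dV dN] := code1 _ _ _ (linked_self L) cd.
have [d1' dV' dN'] := code1 _ _ _ (linked_self (linked_sym L)) cd'.
have [[e dK eK] _] := cd; have [[e' dK' eK'] _] := cd'.
split=> /=.
- by move=> x; have [y xy] := linked_l L (dec x); exists (e' y); rewrite eK'.
- by move=> x; have [y xy] := linked_r L (dec' x); exists (e y); rewrite eK.
- move=> x y /(linked1 L); rewrite -{1}d1 -{1}d1' (inj_eq (can_inj dK)).
  by rewrite (inj_eq (can_inj dK')).
- by move=> x y /(linkedV L); rewrite dV dV'.
by move=> x y i j xy; rewrite dN // dN' //; exact: (linked_npairs L).
Qed.

Section DigitCode.
Variables (T gT : finGroupType) (tsub : T -> T -> T) (pts : seq T).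
Hypothesis tsubE : forall x y, tsub x y = x * y^-1.
Hypothesis mem_pts : forall x, x \in pts.

(* Sending [x] to the product of three elements of orders [ns] with the exponents
   [e x] is onto, and commutes with quotients up to a power map with exponent in [ms]. *)
Definition code_ok (ns : nat * nat * nat) (e : T -> nat * nat * nat) (ms : seq nat) :=
  let: (n1, n2, n3) := ns in
  all (fun x => all (fun y =>
    let: (a1, a2, a3) := e x in
    let: (b1, b2, b3) := e y in
    let: (c1, c2, c3) := e (tsub x y) in
    [&& b1 < n1, b2 < n2, b3 < n3 &
    has (fun m => [&& a1 + (n1 - b1) == m * c1 %[mod n1],
                      a2 + (n2 - b2) == m * c2 %[mod n2] &
                      a3 + (n3 - b3) == m * c3 %[mod n3]]) ms]) pts) pts
  && all (fun i => all (fun j => all (fun k => (i, j, k) \in map e pts)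
       (iota 0 n3)) (iota 0 n2)) (iota 0 n1).

Variables (C : eqType) (col : gT -> C) (ms : seq nat).
Hypothesis abG : abelian [set: gT].
Hypothesis col_expg : forall m g, m \in ms -> col (g ^+ m) = col g.

Lemma digit_coding (u v w : gT) (e : T -> nat * nat * nat) : #|T| = #|gT| ->
  (forall g, exists i j k,
    [/\ i < #[u], j < #[v], k < #[w] & g = u ^+ i * v ^+ j * w ^+ k]) ->
  code_ok (#[u], #[v], #[w]) e ms ->
  exists dec : T -> gT, coding col dec.
Proof.
move=> cTG gen /andP[/allP chk /allP onto].
pose dec x := let: (a, b, c) := e x in u ^+ a * v ^+ b * w ^+ c.
have mulC := abelian_mulgC abG.
exists dec; split.
  (* Injectivity follows by counting, since every triple of exponents is reached. *)
  apply: inj_card_bij; last by rewrite cTG.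
  apply/injectiveP; rewrite /injectiveb /dinjectiveb.
  apply: (leq_size_uniq (enum_uniq gT)); last by rewrite size_map -!cardE cTG.
  move=> g _; have [i [j [k [iu jv kw ->]]]] := gen g.
  have := onto i; rewrite mem_iota => /(_ iu)/allP/(_ j); rewrite mem_iota.
  move=> /(_ jv)/allP/(_ k); rewrite mem_iota => /(_ kw)/mapP[x _ ex].
  by apply/mapP; exists x; rewrite ?mem_enum // /dec -ex.
move=> x y; have /allP/(_ y (mem_pts _)) := chk x (mem_pts _).
rewrite -tsubE /dec; case: (e x) => [[a1 a2] a3]; case: (e y) => [[b1 b2] b3].
case: (e _) => [[c1 c2] c3] /and4P[b1n b2n b3n /hasP[m mm /and3P[]]] /eqP E1 /eqP E2 /eqP E3.
(* The exponent [a - b] modulo the order of [t], written without subtracting below zero. *)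
have E (t : gT) a b c : b < #[t] -> a + (#[t] - b) = m * c %[mod #[t]] ->
    t ^+ a * (t ^+ b)^-1 = (t ^+ c) ^+ m.
  move=> bt e'; rewrite -expgM mulnC -(expg_mod_order t (m * c)) -e' expg_mod_order.
  rewrite expgD; congr (_ * _); apply/eqP.
  by rewrite eq_invg_mul -expgD subnKC ?expg_order // ltnW.
rewrite -(col_expg _ mm) !expgMn; try exact: mulC.
congr col; rewrite -(E _ _ _ _ b1n E1) -(E _ _ _ _ b2n E2) -(E _ _ _ _ b3n E3).
have AC (a1' a2' b1' b2' : gT) : (a1' * b1'^-1) * (a2' * b2'^-1) = (a1' * a2') * (b2'^-1 * b1'^-1).
  by rewrite -!mulgA; congr (_ * _); rewrite [RHS]mulgA [RHS]mulC.
by rewrite AC -invMg AC -invMg.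
Qed.
End DigitCode.

(** * Groups of order 8 and 27 read through base-p digits *)

Lemma pair_abelian (gT hT : finGroupType) :
  abelian [set: gT] -> abelian [set: hT] -> abelian [set: gT * hT].
Proof.
move=> abg abh; apply/centsP => -[a b] _ [c d] _.
by congr (_, _); exact: abelian_mulgC.
Qed.

(** A bare enumeration, so that the computations below carry no proof terms as ordinals would. *)
Inductive trit := T0 | T1 | T2.
Definition nat_of_trit x := match x with T0 => 0%N | T1 => 1%N | T2 => 2%N end.
Definition trit_of_nat n := match n with 0%N => T0 | 1%N => T1 | _ => T2 end.
Fact nat_of_tritK : cancel nat_of_trit trit_of_nat. Proof. by case. Qed.
HB.instance Definition _ := Countable.copy trit (can_type nat_of_tritK).
Fact trit_enumP : Finite.axiom [:: T0; T1; T2]. Proof. by case. Qed.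
HB.instance Definition _ := isFinite.Build trit trit_enumP.

Definition trit_opp x := match x with T0 => T0 | T1 => T2 | T2 => T1 end.
Definition trit_add x y :=
  match x, y with
  | T0, z | z, T0 => z
  | T1, T2 | T2, T1 => T0
  | T1, T1 => T2
  | T2, T2 => T1
  end.
Fact trit_addA : associative trit_add. Proof. by do 3!case. Qed.
Fact trit_add0 : left_id T0 trit_add. Proof. by case. Qed.
Fact trit_addr0 : right_id T0 trit_add. Proof. by case. Qed.
Fact trit_addN : left_inverse T0 trit_opp trit_add. Proof. by case. Qed.
Fact trit_addrN : right_inverse T0 trit_opp trit_add. Proof. by case. Qed.
HB.instance Definition _ := isGroup.Build trit trit_addA trit_add0 trit_addr0 trit_addN trit_addrN.

Definition trit_sub x y :=
  match x, y with
  | _, T0 => x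
  | T1, T1 | T2, T2 => T0
  | T0, T2 | T2, T1 => T1
  | T0, T1 | T1, T2 => T2
  end.
Definition trit_mul x y :=
  match x, y with
  | T0, _ | _, T0 => T0
  | T1, z | z, T1 => z
  | T2, T2 => T1
  end.

Section CubeCode.
Variables (D : finGroupType) (digits : seq D) (dsub : D -> D -> D) (val : D -> nat).
Local Notation cube := (D * D * D)%type.

Definition cube_pts : seq cube :=
  [seq (x, c) | x <- [seq (a, b) | a <- digits, b <- digits], c <- digits].

Lemma mem_cube_pts : (forall d, d \in digits) -> forall x, x \in cube_pts.
Proof.
by move=> md [[a b] c]; apply: allpairs_f; rewrite ?md //; exact: allpairs_f.
Qed.

Definition cube_sub (x y : cube) : cube :=
  let: (a, b, c) := x in let: (d, e, f) := y in (dsub a d, dsub b e, dsub c f).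

Lemma cube_subE : (forall a b, dsub a b = a * b^-1) -> forall x y, cube_sub x y = x * y^-1.
Proof. by move=> dsubE [[a b] c] [[d e] f]; rewrite /= !dsubE. Qed.

(** In the cyclic group the three coordinates are the digits of one exponent; in type [(p^2, p)] the
    first two are. *)
Definition exponents p (orders : nat * nat * nat) (x : cube) : nat * nat * nat :=
  let: (a, b, c) := x in
  let: (_, n2, n3) := orders in
  if n2 == 1%N then (val a + p * val b + p ^ 2 * val c, 0, 0)%N else
  if n3 == 1%N then (val a + p * val b, val c, 0)%N else (val a, val b, val c).

(* [rs] pairs exponents congruent to 1 mod p with primes having the same residue
   mod p^3, to which [linked_expg] applies. *)
Lemma cube_coding p (rs : seq (nat * nat)) (C : finType) (gT gT' : finGroupType)
   (col : gT -> C) (col' : gT' -> C) :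
  prime p -> #|D| = p -> (forall d, d \in digits) -> (forall a b, dsub a b = a * b^-1) ->
  all (fun r => [&& prime r.2, r.2 == 1 %[mod p] & r.1 == r.2 %[mod p ^ 3]]) rs ->
  all (fun ns => code_ok cube_sub cube_pts ns (exponents p ns) (1%N :: unzip1 rs))
    [:: (p ^ 3, 1, 1); (p ^ 2, p, 1); (p, p, p)]%N ->
  abelian [set: gT] -> abelian [set: gT'] -> (forall x : gT, x ^+ p = 1) -> #|gT| = (p ^ 3)%N ->
  linked col col' -> exists dec : cube -> gT', coding col' dec.
Proof.
move=> pp cD md dsubE okr /allP okc abG abG' expG cG L.
have cG' : #|gT'| = (p ^ 3)%N by rewrite -(linked_card L).
have [u [v [w [gen ords]]]] := abelian_p3_generators pp abG' cG'.
apply: (digit_coding (cube_subE dsubE) (mem_cube_pts md) abG' _ _ gen (okc _ ords)); last first.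
  by rewrite cG' !card_prod cD !expnS mulnA muln1.
move=> m g; rewrite inE => /predU1P[->|]; first by rewrite expg1.
case/mapP => -[r q] rqs /= ->; have /and3P[/= pq q1 rq] := allP okr _ rqs.
have -> : g ^+ r = g ^+ q.
  have gp : g ^+ (p ^ 3) = 1 by rewrite -cG' -cardsT expg_cardG ?inE.
  by rewrite -(expg_mod r gp) (eqP rq) expg_mod.
refine (linked_expg g abG abG' L pq _ _).
  rewrite cG' coprimeXr // prime_coprime //; rewrite dvdn_prime2 //.
  by apply/eqP => qp; have := eqP q1; rewrite qp modnn modn_small ?prime_gt1.
by move=> x /=; rewrite -(expg_mod q (expG x)) (eqP q1) modn_small ?prime_gt1.
Qed.

End CubeCode.

Lemma trit_coding (C : finType) (gT gT' : finGroupType) (col : gT -> C) (col' : gT' -> C) :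
  abelian [set: gT] -> abelian [set: gT'] -> (forall x : gT, x ^+ 3 = 1) -> #|gT| = 27 ->
  linked col col' -> exists dec : trit * trit * trit -> gT', coding col' dec.
Proof.
(* All residues modulo 27 that are 1 modulo 3, except 1, each with the least prime congruent to
   it. *)
apply: (cube_coding (p := 3) (digits := [:: T0; T1; T2]) (dsub := trit_sub) (val := nat_of_trit)
   (rs := [:: (4, 31); (7, 7); (10, 37); (13, 13); (16, 43); (19, 19); (22, 103); (25, 79)])%N).
- by [].
- by rewrite cardT enumT unlock.
- by case.
- by do 2!case.
- by vm_compute.
by vm_compute.
Qed.

Lemma bool_coding (C : finType) (gT gT' : finGroupType) (col : gT -> C) (col' : gT' -> C) :
  abelian [set: gT] -> abelian [set: gT'] -> (forall x : gT, x ^+ 2 = 1) -> #|gT| = 8 ->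
  linked col col' -> exists dec : bool * bool * bool -> gT', coding col' dec.
Proof.
(* The odd residues modulo 8 other than 1 are themselves prime. *)
apply: (cube_coding (p := 2) (digits := [:: false; true]) (dsub := addb) (val := nat_of_bool)
   (rs := [:: (3, 3); (5, 5); (7, 7)])%N).
- by [].
- exact: card_bool.
- by case.
- by do 2!case.
- by vm_compute.
by vm_compute.
Qed.

(** * Exhaustive search *)

(* [vm_compute] evaluates arguments first, so [&&], [||], [all] and [has] do not short-cut. *)
Fixpoint every T (a : pred T) (s : seq T) :=
  if s is x :: s' then if a x then every a s' else false else true.
Fixpoint some T (a : pred T) (s : seq T) :=
  if s is x :: s' then if a x then true else some a s' else false.
Fixpoint same T (e : T -> T -> bool) (s t : seq T) :=
  match s, t with
  | [::], [::] => true
  | x :: s', y :: t' => if e x y then same e s' t' else false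
  | _, _ => false
  end.

Lemma everyE T (a : pred T) s : every a s = all a s.
Proof. by elim: s => //= x s ->; case: (a x). Qed.
Lemma someE T (a : pred T) s : some a s = has a s.
Proof. by elim: s => //= x s ->; case: (a x). Qed.
Lemma sameP (T : eqType) e : (forall x y : T, e x y = (x == y)) ->
  forall s t, same e s t = (s == t).
Proof. by move=> eE; elim=> [|x s IHs] [|y t] //=; rewrite eE eqseq_cons IHs; case: eqP. Qed.

Definition same_key := same (same eqn).
Lemma same_keyE s t : same_key s t = (s == t).
Proof. by apply: sameP => x y; apply: sameP => i j; rewrite eqnE. Qed.

Definition histogram s := foldr (fun i h => incr_nth h i) [::] s.

Lemma perm_histogram s t : perm_eq s t -> histogram s = histogram t.
Proof.
apply: catCA_perm_subst => {s t}; elim=> // x s1 IH s2 u /=; rewrite IH.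
by elim: s2 => //= y s2 <-; rewrite incr_nthC.
Qed.

Fixpoint selections T (s : seq (seq T)) : seq (seq T) :=
  if s is xs :: s' then
    let l := selections s' in flatten [seq [seq x :: y | y <- l] | x <- xs]
  else [:: [::]].

Lemma selectionsP (S T : eqType) (f : S -> T) (g : S -> seq T) s :
  {in s, forall x, f x \in g x} -> map f s \in selections (map g s).
Proof.
elim: s => //= x s IHs fg; apply/flatten_mapP; exists (f x); first exact/fg/mem_head.
by apply/map_f/IHs => y ys; apply: fg; rewrite inE ys orbT.
Qed.

Lemma selections_sub (T : eqType) (s : seq (seq T)) y :
  y \in selections s -> {subset y <= flatten s}.
Proof.
elim: s y => [|xs s IHs] y /=; first by rewrite inE => /eqP->.
case/flatten_mapP=> x xxs /mapP[z /IHs zs ->] t; rewrite inE mem_cat.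
by case/predU1P => [->|/zs->]; rewrite ?xxs ?orbT.
Qed.

Lemma flatten_uniq (S T : eqType) (f : S -> seq T) s : uniq s -> (forall x, uniq (f x)) ->
  {in s &, forall x y z, z \in f x -> z \in f y -> x = y} -> uniq (flatten (map f s)).
Proof.
move=> + uf; elim: s => //= x s IHs /andP[xs us] inj.
rewrite cat_uniq uf IHs //= ?andbT; last first.
  by move=> y z ys zs; apply: inj; rewrite inE ?ys ?zs orbT.
apply/hasPn => z /flatten_mapP[y ys zy]; apply: contraNN xs => zx.
by rewrite (inj x y _ _ z) // inE ?eqxx ?ys ?orbT.
Qed.

(* Maps stored as data: the values of a closure are recomputed at each application. *)
Record tabling (T : eqType) := Tabling {
  tab : Type -> Type;
  get : forall A, tab A -> T -> A;
  mk : forall A, (T -> A) -> tab A;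
  put : forall A, tab A -> T -> A -> tab A;
  get_mk : forall A f x, get (@mk A f) x = f x;
  get_put : forall A t x (a : A) y, get (put t x a) y = if y == x then a else get t y
}.

Section ProdTab.
Variables (T U : eqType) (t : tabling T) (u : tabling U).
Definition pair_tab A := tab t (tab u A).
Definition pair_get A (f : pair_tab A) x := get (get f x.1) x.2.
Definition pair_mk A (f : T * U -> A) : pair_tab A := mk t (fun a => mk u (fun b => f (a, b))).
Definition pair_put A (f : pair_tab A) x y : pair_tab A := put f x.1 (put (get f x.1) x.2 y).
Fact pair_get_mk A (f : T * U -> A) x : pair_get (pair_mk f) x = f x.
Proof. by case: x => a b; rewrite /pair_get !get_mk. Qed.
Fact pair_get_put A (f : pair_tab A) x y z :
  pair_get (pair_put f x y) z = if z == x then y else pair_get f z.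
Proof.
case: x z => [a b] [c d]; rewrite /pair_get /pair_put /= get_put xpair_eqE.
by case: (c =P a) => [->|//]; rewrite get_put.
Qed.
Definition prod_tab : tabling (T * U)%type :=
  @Tabling (T * U)%type pair_tab _ _ _ pair_get_mk pair_get_put.
End ProdTab.
Arguments prod_tab {T U} t u.

(* [tsub] is a fast version of [x * y^-1] and [pts] an enumeration of the elementary
   abelian group [T]. The endomorphism [lin ws] sends the standard basis to [ws], and
   [flag] lists the points added by each basis vector to the span of the previous ones. *)
Section Search.
Variables (T : finGroupType) (tsub : T -> T -> T) (pts : seq T) (tb : tabling T).
Variables (lin : seq T -> T -> T) (flag : seq (seq T)).
Local Notation tab := (tab tb).
Local Notation get := (@get _ tb _).
Local Notation mk := (@mk _ tb _).
Local Notation put := (@put _ tb _).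

(** Intersection numbers at [z]: one factor lies in [S], the other is counted by its colour. *)
Definition profile (c : tab nat) S z :=
  foldr (fun x h => incr_nth h (get c (tsub z x))) [::] S.

Definition block (c : tab nat) i := [seq v <- pts | eqn (get c v) i].

Definition ncol (c : tab nat) := (foldr (fun v n => maxn (get c v) n) 0 pts).+1.

(** One step of Weisfeiler-Leman refinement. *)
Definition signature (c : tab nat) : tab (seq (seq nat)) :=
  let Bs := [seq block c i | i <- iota 0 (ncol c)] in
  mk (fun z => [:: get c z] :: [seq profile c B z | B <- Bs]).

Definition split_classes (c : tab nat) : tab nat :=
  let sg := signature c in
  let keys :=
    foldr (fun v r => if some (same_key (get sg v)) r then r else get sg v :: r) [::] pts in
  mk (fun v => find (same_key (get sg v)) keys).

(* False if a block known to be one class ([None], see [solve]) gets split: then the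
   assumptions made so far are contradictory. *)
Definition unsplit (s : tab (option nat)) (c c' : tab nat) :=
  every (fun v => if get s v then true else
    every (fun w => if eqn (get c w) (get c v) then eqn (get c' w) (get c' v) else true) pts) pts.

(** Stopping when the fuel runs out is sound: every intermediate colouring is still coarser than the
    two given ones. *)
Fixpoint refine n (c : tab nat) (s : tab (option nat)) : option (tab nat) :=
  let c' := split_classes c in
  if unsplit s c c' then
    if ncol c' == ncol c then Some c' else if n is n'.+1 then refine n' c' s else Some c'
  else None.

Definition half (B : seq T) := [seq x <- B | index x pts <= index (tsub 1 x) pts].

(* In the symmetric phase classes are closed under inversion. In the other phase a block
   is contained in [X :|: X^-1] for some class [X], so a proper class in it contains one of
   [x] and [x^-1] for each element [x] of the block, which has then to be closed under
   inversion. *)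
Definition cands (sym : bool) (B : seq T) : seq (seq T) :=
  if every (fun x => tsub 1 x \in B) B then
    map flatten (selections
      [seq if sym then [:: [::]; undup [:: x; tsub 1 x]] else [:: [:: x]; [:: tsub 1 x]]
         | x <- half B])
  else [::].

Definition agree (c1 c0 : tab nat) ws :=
  let h := lin ws in every (fun v => eqn (get c1 (h v)) (get c0 v)).

(** Backtracking over the images of the basis vectors: each choice is tested at once on the points
    that it newly determines. *)
Fixpoint equivb (c1 c0 : tab nat) ws fl : bool :=
  if fl is vs :: fl' then
    some (fun w => let ws' := rcons ws w in
           if agree c1 c0 ws' vs then equivb c1 c0 ws' fl' else false) pts
  else agree c1 c0 ws pts.

(** A class has the same intersection numbers at all its points, so a candidate with varying profile
    is dropped. The common profile is the key, and the candidate receives the fresh colour [r]. *)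
Definition keyed (c : tab nat) (r lo hi : nat) (l : seq T) : option (seq nat * tab nat) :=
  if (lo <= size l) && (size l <= hi) then
    let c1 := foldr (fun x t => put t x r) c l in
    if l is x :: l' then
      let k := profile c1 l x in
      if every (fun z => same eqn (profile c1 l z) k) l' then Some (k, c1) else None
    else None
  else None.

(* Makes the endomorphisms found by [equivb] injective. *)
Definition isolates1 (c : tab nat) :=
  every (fun v => if eqn (get c v) (get c 1) then v == 1 else true) pts.

Variables (sym : bool) (leaf : tab nat -> bool).

(* [c] is a colouring known to be coarser than the two given ones and to take the same
   values on elements of the same colour. The status [get s v] is [None] if the block of
   [v] is one class of the given colourings, and [Some m] if all the classes inside this
   block have at least [m] elements. Either a block is one class, or it contains a smallest
   class, with at least [m] and at most half of the elements of the block. The class and its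
   partner in the second group are both candidates, with the same profile, so that two
   automorphisms send them to one representative. *)
Fixpoint solve n (c : tab nat) (s : tab (option nat)) : bool :=
  if n is n'.+1 then
    if [seq v <- pts | get s v] is v :: vs then
      let smaller u v := if size (block c (get c u)) < size (block c (get c v)) then u else v in
      let v0 := foldr smaller v vs in
      let m := odflt 0 (get s v0) in
      let i := get c v0 in
      let B := block c i in
      let b := size B in
      let r := ncol c in
      let K := if m.*2 <= b then pmap (keyed c r m b./2) (cands sym B) else [::] in
      if every (fun k =>
          let G := [seq x.2 | x <- K & x.1 == k] in
          if G is c0 :: _ then
            if isolates1 c0 then
            if every (fun c1 => equivb c1 c0 [::] flag) G then
              let sz := size (block c0 r) in
              let s' := mk (fun v => if eqn (get c v) i then
                               if eqn (get c0 v) r then None else Some sz else get s v) in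
              if refine n' c0 s' is Some c' then solve n' c' s' else true
            else false
            else false
          else true) (undup (unzip1 K))
      (* Once proper classes are dealt with, the block is one class, which is absurd below the bound
         [m]. *)
      then if b < m then true else
        solve n' c (mk (fun v => if eqn (get c v) i then None else get s v))
      else false
    else leaf c
  else false.
End Search.

(** * Automorphisms and symmetrized colourings *)

Section Sound.
Variables (T : finGroupType) (C : finType).
Hypothesis abT : abelian [set: T].
Let mulC := abelian_mulgC abT.

Definition automorphism (g : T -> T) :=
  bijective g /\ forall x y, g (x * y^-1) = g x * (g y)^-1.

Definition same_upto (col col' : T -> C) :=
  exists2 g, automorphism g & forall v, col' (g v) = col v.

Lemma automorphism1 g : automorphism g -> g 1 = 1.
Proof. by case=> _ gM; have := gM 1 1; rewrite !mulgV. Qed.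

Lemma automorphismV g x : automorphism g -> g x^-1 = (g x)^-1.
Proof. by move=> ag; have := ag.2 1 x; rewrite (automorphism1 ag) !mul1g. Qed.

(** Lets the search replace each colouring by its pull-back along an automorphism. *)
Lemma same_upto_comp g g' (col col' : T -> C) : automorphism g -> automorphism g' ->
  same_upto (col \o g) (col' \o g') -> same_upto col col'.
Proof.
move=> [bg gM] [bg' g'M] [h [bh hM] colh]; have [f fK Kf] := bg.
exists (g' \o h \o f) => [|v]; last by have := colh (f v); rewrite /= Kf.
split; first by apply: bij_comp; [exact: bij_comp | exists g].
by move=> x y /=; rewrite -{1}[x]Kf -{1}[y]Kf -gM fK hM g'M.
Qed.

Lemma linked_automorphism g g' (col col' : T -> C) : automorphism g -> automorphism g' ->
  linked col col' -> linked (col \o g) (col' \o g').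
Proof.
move=> [bg gM] [bg' g'M] L.
by apply: (linked_coding abT abT abT L); split=> // x y; rewrite ?gM ?g'M.
Qed.

(* The colouring, or its symmetrization, as sets of colours. *)
Definition kol (sym : bool) (col : T -> C) v : {set C} :=
  if sym then [set col v; col v^-1] else [set col v].

Lemma kol_automorphism sym col g v : automorphism g -> kol sym (col \o g) v = kol sym col (g v).
Proof. by move=> ag; rewrite /kol /= automorphismV. Qed.

Section Kol.
Variables (sym : bool) (col col' : T -> C).
Hypothesis L : linked col col'.

Lemma col_kol z z' : col z = col' z' -> kol sym col z = kol sym col' z'.
Proof. by move=> e; rewrite /kol e (linkedV L e). Qed.

Lemma kol_col z z' : kol sym col z = kol sym col' z' ->
  col z = col' z' \/ sym /\ col z = col' z'^-1.
Proof.
rewrite /kol; case: sym => e; have : col z \in [set col z; col z^-1] by rewrite set21.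
  by rewrite e => /set2P[->|->]; [left|right].
by move: e => /setP/(_ (col z)); rewrite set11 => /esym/set1P ->; left.
Qed.

Lemma kolV z : sym -> kol sym col z^-1 = kol sym col z.
Proof. by rewrite /kol => ->; rewrite invgK setUC. Qed.

End Kol.

(** By commutativity, inverting both factors turns a factorization of [z] into one of [z^-1] with
    the same symmetrized colours. *)
Lemma npairs_kolV (col : T -> C) i j z :
  npairs (kol true col) i j z^-1 = npairs (kol true col) i j z.
Proof.
rewrite /npairs -(on_card_preimset (f := invg)); last by exists invg => x _; rewrite invgK.
congr #|pred_of_set _|; apply/setP=> h; rewrite !inE kolV //; congr (_ && (_ == _)).
by rewrite invgK mulC -[RHS]kolV // invMg invgK.
Qed.

(** The symmetrized colour is the same function [F] of the colour on both sides, so its intersection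
    numbers are sums of the old ones. *)
Lemma linked_kol sym (col col' : T -> C) : linked col col' -> linked (kol sym col) (kol sym col').
Proof.
move=> L.
pose F i := if sym then [set i; col (odflt 1 [pick x | col x == i])^-1] else [set i].
have FE x : kol sym col x = F (col x).
  rewrite /kol /F; case: ifP => // _; case: pickP => [y /eqP yx|/(_ x)]; last by rewrite eqxx.
  by rewrite /= (linkedV (linked_self L) yx).
have FE' x : kol sym col' x = F (col' x).
  by have [y yx] := linked_r L x; rewrite -(col_kol _ L yx) FE yx.
have nF i j z z' : col z = col' z' -> npairs (kol sym col) i j z = npairs (kol sym col') i j z'.
  move=> zz'.
  have -> : npairs (kol sym col) i j z = npairs (F \o col) i j z.
    by congr #|pred_of_set _|; apply/setP=> h; rewrite !inE /= -!FE.
  have -> : npairs (kol sym col') i j z' = npairs (F \o col') i j z'.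
    by congr #|pred_of_set _|; apply/setP=> h; rewrite !inE /= -!FE'.
  rewrite !npairs_map; apply: eq_bigr => a _; apply: eq_bigr => b _.
  exact: (linked_npairs L).
split=> [x|x|x y xy|x y xy|x y i j xy].
- by have [y xy] := linked_l L x; exists y; exact: (col_kol _ L).
- by have [y xy] := linked_r L x; exists y; exact: (col_kol _ L).
- by case: (kol_col xy) => [|[_]] /(linked1 L) -> //; rewrite invg_eq1.
- case: (kol_col xy) => [|[s]] /(linkedV L) e; first exact: (col_kol _ L).
  by rewrite (col_kol _ L e) kolV.
case: (kol_col xy) => [|[s]] e; first exact: nF.
by rewrite (nF _ _ _ _ e) s npairs_kolV.
Qed.

End Sound.

(** * Soundness of the search *)

Lemma foldr_select (T : eqType) (p : rel T) v s :
  foldr (fun u w => if p u w then u else w) v s \in v :: s.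
Proof.
elim: s => [|x s IH] /=; first exact: mem_head.
by move: IH; case: ifP => _; rewrite !inE ?eqxx ?orbT // => /orP[]->; rewrite ?orbT.
Qed.

Section Keyed.
Variables (S K : eqType) (A : Type) (f : S -> option (K * A)).

Lemma mem_keys s l k c : l \in s -> f l = Some (k, c) -> k \in unzip1 (pmap f s).
Proof.
move=> + fl; elim: s => //= l1 s IH; rewrite inE => /predU1P[<-|/IH ks].
  by rewrite fl /= mem_head.
by case: (f l1) => //= x; rewrite inE ks orbT.
Qed.

Lemma all_keyed s k a : all a [seq x.2 | x <- pmap f s & x.1 == k] ->
  forall l c, l \in s -> f l = Some (k, c) -> a c.
Proof.
move=> + l c + fl; elim: s => //= l1 s IH; rewrite inE => al /predU1P[ll1|ls].
  by move: al; rewrite -ll1 fl /= eqxx => /andP[].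
apply: IH ls; move: al; case: (f l1) => //= x.
by case: ifP => //= _ /andP[].
Qed.

Lemma head_keyed s k c G : [seq x.2 | x <- pmap f s & x.1 == k] = c :: G ->
  exists2 l, l \in s & f l = Some (k, c).
Proof.
elim: s => //= l1 s IH; case fl: (f l1) => [[k1 c1]|] /=.
  case: eqP => [kk [<- _]|_ /IH[l ls fk]]; first by exists l1; rewrite ?mem_head ?fl ?kk.
  by exists l; rewrite // inE ls orbT.
by move=> /IH[l ls fk]; exists l; rewrite // inE ls orbT.
Qed.

End Keyed.

Section SearchSound.
Variables (T : finGroupType) (tsub : T -> T -> T) (pts : seq T) (tb : tabling T).
Variables (lin : seq T -> T -> T) (flag : seq (seq T)).
Hypothesis abT : abelian [set: T].
Hypothesis tsubE : forall x y, tsub x y = x * y^-1.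
Hypothesis mem_pts : forall x, x \in pts.
Hypothesis uniq_pts : uniq pts.
Hypothesis linM : forall ws x y, lin ws (x * y^-1) = lin ws x * (lin ws y)^-1.
Local Notation tab := (tab tb).
Local Notation get := (@get _ tb _).
Local Notation mk := (@mk _ tb _).
Local Notation put := (@put _ tb _).
Local Notation profile := (@profile T tsub tb).
Local Notation block := (@block T pts tb).
Local Notation ncol := (@ncol T pts tb).

Let mulC := abelian_mulgC abT.

Lemma tsub1 x : tsub 1 x = x^-1. Proof. by rewrite tsubE mul1g. Qed.

Lemma size_card (l : seq T) (P : pred T) : uniq l -> (forall x, (x \in l) = P x) ->
  size l = #|[set x | P x]|.
Proof.
move=> ul lP; rewrite -(card_uniqP ul); apply: eq_card => x.
by rewrite !inE lP.
Qed.

Lemma mem_block c i v : (v \in block c i) = (get c v == i).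
Proof. by rewrite mem_filter mem_pts andbT eqnE. Qed.

Lemma uniq_block c i : uniq (block c i).
Proof. exact: filter_uniq. Qed.

Lemma get_lt_ncol c v : get c v < ncol c.
Proof.
rewrite /ncol ltnS; elim: pts (mem_pts v) => //= x s IH; rewrite inE leq_max.
by case/predU1P => [->|/IH->]; rewrite ?leqnn ?orbT.
Qed.

Lemma get_recolour (c : tab nat) r l v :
  get (foldr (fun x t => put t x r) c l) v = if v \in l then r else get c v.
Proof. by elim: l => //= x l IH; rewrite get_put inE IH; case: eqP. Qed.

(** Every entry of a profile is a sum of intersection numbers, over the same colours on both
    sides. *)
Lemma profile_linked (D : finType) (k k' : T -> D) (c c' : tab nat) F (P : pred D) l l' z z' :
  linked k k' -> (forall v, get c v = F (k v)) -> (forall v, get c' v = F (k' v)) ->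
  uniq l -> uniq l' -> (forall x, (x \in l) = P (k x)) -> (forall x, (x \in l') = P (k' x)) ->
  k z = k' z' -> profile c l z = profile c' l' z'.
Proof.
move=> L cF c'F ul ul' lP l'P zz'.
have E (e : tab nat) s t : profile e s t = histogram [seq get e (tsub t x) | x <- s].
  by rewrite /profile /histogram foldr_map.
rewrite !E; apply: perm_histogram; apply/seq.permP => a; rewrite !count_map.
have Ec (e : tab nat) (h : T -> D) s t : (forall v, get e v = F (h v)) -> uniq s ->
    (forall x, (x \in s) = P (h x)) ->
    count (preim (fun x => get e (tsub t x)) a) s
      = \sum_(i | P i) \sum_(j | a (F j)) npairs h i j t.
  move=> eF us sP; rewrite -card_npairs -size_filter.
  apply: size_card => [|x]; first exact: filter_uniq.
  by rewrite mem_filter sP andbC /= eF tsubE mulC.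
rewrite (Ec _ _ _ _ cF ul lP) (Ec _ _ _ _ c'F ul' l'P).
by apply: eq_bigr => i _; apply: eq_bigr => j _; exact: (linked_npairs L).
Qed.

Section Factor.
Variables (D : finType) (k k' : T -> D).
Hypothesis L : linked k k'.

Lemma factor_colouring (c : tab nat) : (forall z z', k z = k' z' -> get c z = get c z') ->
  exists F, (forall v, get c v = F (k v)) /\ (forall v, get c v = F (k' v)).
Proof.
move=> ck; exists (fun i => get c (odflt 1 [pick x | k x == i])); split=> v.
  case: pickP => [x /eqP xv|/(_ v)]; last by rewrite eqxx.
  by have [y vy] := linked_l L v; rewrite (ck _ _ vy) (ck x y) //= xv.
case: pickP => [x /eqP /ck->//|none].
by have [y yv] := linked_r L v; have := none y; rewrite yv eqxx.
Qed.

Lemma signature_linked (c : tab nat) z z' : (forall z z', k z = k' z' -> get c z = get c z') ->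
  k z = k' z' -> get (signature tsub pts c) z = get (signature tsub pts c) z'.
Proof.
move=> ck zz'; have [F [cF cF']] := factor_colouring ck.
rewrite !get_mk; congr cons; first by rewrite (ck z z').
rewrite -!map_comp; apply: eq_map => i /=.
apply: (profile_linked (F := F) (P := fun j => F j == i) L) => //; try exact: uniq_block.
- by move=> x; rewrite mem_block cF.
by move=> x; rewrite mem_block cF'.
Qed.

Lemma split_classes_linked (c : tab nat) z z' :
  (forall z z', k z = k' z' -> get c z = get c z') ->
  k z = k' z' -> get (split_classes tsub pts c) z = get (split_classes tsub pts c) z'.
Proof. by move=> ck zz'; rewrite [LHS]get_mk [RHS]get_mk (signature_linked ck zz'). Qed.

Lemma split_classes_finer (c : tab nat) v w :
  get (split_classes tsub pts c) v = get (split_classes tsub pts c) w -> get c v = get c w.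
Proof.
rewrite [LHS]get_mk [get _ w]get_mk; set sg := signature _ _ _; set keys := foldr _ _ _.
have hk x : has (same_key (get sg x)) keys.
  rewrite /keys; elim: pts (mem_pts x) => //= y t IH; rewrite inE => /predU1P[->|/IH h].
    by case: ifP; rewrite ?someE //= same_keyE eqxx.
  by case: ifP => //= _; rewrite h orbT.
move=> vw; have := nth_find [::] (hk v); have := nth_find [::] (hk w).
by rewrite vw !same_keyE => /eqP<- /eqP; rewrite !get_mk => -[].
Qed.

(** Elements of one colour are never separated, so a block known to be a class stays whole and
    [None] cannot occur. *)
Lemma refine_sound n (c : tab nat) (s : tab (option nat)) :
  (forall z z', k z = k' z' -> get c z = get c z') ->
  (forall v w, get s v = None -> get c w = get c v -> k w = k v) ->
  if refine tsub pts n c s is Some c' then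
    (forall z z', k z = k' z' -> get c' z = get c' z') /\
    (forall v w, get c' v = get c' w -> get c v = get c w)
  else False.
Proof.
elim: n c => [|n IHn] c ck sk /=;
  (have -> : unsplit pts s c (split_classes tsub pts c)
     by rewrite /unsplit everyE; apply/allP => v _; case sv: (get s v) => [//|];
        rewrite everyE; apply/allP => w _; rewrite !eqnE; case: eqP => // /(sk _ _ sv) wv;
        have [y vy] := linked_l L v; rewrite (split_classes_linked ck vy);
        rewrite (@split_classes_linked c w y) ?eqxx // wv).
  by case: ifP => _; split=> [z z'|v w]; [exact: split_classes_linked|exact: split_classes_finer
    |exact: split_classes_linked|exact: split_classes_finer].
case: ifP => _.
  by split=> [z z'|v w]; [exact: split_classes_linked|exact: split_classes_finer].
have := IHn (split_classes tsub pts c); case: refine => [c''|] H.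
  case: H => [z z'|v w sv /split_classes_finer|H1 H2].
  - exact: split_classes_linked.
  - exact: sk.
  by split=> // v w /H2 /split_classes_finer.
by apply: H => [z z'|v w sv /split_classes_finer]; [exact: split_classes_linked|exact: sk].
Qed.

End Factor.

(** A pair of mutual inverses meets [P] in all or none of its elements in the symmetric phase, and
    in exactly one in the other phase; these are the choices that [cands] lists. *)
Lemma cands_complete sym B (P : pred T) : uniq B -> (forall x, x \in B -> x^-1 \in B) ->
  (forall x, x \in B -> P x^-1 = (if sym then P x else ~~ P x)) ->
  exists l, [/\ l \in cands tsub pts sym B, uniq l & forall x, (x \in l) = (x \in B) && P x].
Proof.
move=> uB BV PV; rewrite /cands everyE.
have -> : all (fun x => tsub 1 x \in B) B by apply/allP => x xB; rewrite tsub1 BV.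
pose f x := [seq y <- undup [:: x; x^-1] | P y].
have fP x y : y \in f x = P y && ((y == x) || (y == x^-1)).
  by rewrite mem_filter mem_undup !inE.
have mem_half x : x \in B -> (x \in half tsub pts B) || (x^-1 \in half tsub pts B).
  by move=> xB; rewrite !mem_filter !tsub1 invgK xB (BV x xB) !andbT leq_total.
exists (flatten (map f (half tsub pts B))); split.
- apply: map_f; apply: selectionsP => x; rewrite mem_filter => /andP[_ /PV].
  rewrite /f tsub1; case: (sym) => /= PVx.
    by case: ifP => _ /=; rewrite PVx; case: (P x); rewrite !inE eqxx ?orbT.
  have /negPf xV : x != x^-1 by apply/eqP => e; move: PVx; rewrite -e; case: (P x).
  by rewrite mem_seq1 xV /= PVx; case: (P x); rewrite !inE eqxx ?orbT.
- apply: flatten_uniq => [|x|x y]; rewrite ?filter_uniq ?undup_uniq //.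
  rewrite !mem_filter !tsub1 => /andP[xh xB] /andP[yh yB] z.
  rewrite !fP => /andP[_ zx] /andP[_ zy].
  have [//|xy] : x = y \/ x = y^-1.
    move: zx zy => /orP[]/eqP-> /orP[]/eqP; [by left|by right| |by move/invg_inj; left].
    by move=> <-; rewrite invgK; right.
  suff : index x pts = index y pts by move/(congr1 (nth x pts)); rewrite !nth_index.
  have yx : x^-1 = y by rewrite xy invgK.
  by apply/eqP; move: xh yh; rewrite eqn_leq yx -xy => -> ->.
move=> x; apply/flatten_mapP/andP => [[y]|[xB Px]].
  rewrite mem_filter fP => /andP[_ yB] /andP[Px xy]; split=> //.
  by case/predU1P: xy => [->//|/eqP->]; exact: BV.
have /orP[xh|xh] := mem_half _ xB; first by exists x; rewrite // fP Px eqxx.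
by exists x^-1; rewrite // fP Px invgK eqxx orbT.
Qed.

Lemma cands_sub sym B l : l \in cands tsub pts sym B -> {subset l <= B}.
Proof.
rewrite /cands everyE; case: ifP => // /allP BV /mapP[y /selections_sub ys ->] x.
case/flattenP=> z /ys /flatten_mapP[t]; rewrite mem_filter => /andP[_ tB] + xz.
have tV : tsub 1 t \in B := BV t tB.
have sub2 : {subset [:: t; tsub 1 t] <= B} by move=> w; rewrite !inE => /orP[]/eqP->.
case: ifP => _; rewrite !inE => /orP[]/eqP zE; move: xz; rewrite zE //.
- by rewrite mem_undup; exact: sub2.
- by rewrite mem_seq1 => /eqP->.
by rewrite mem_seq1 => /eqP->.
Qed.

Lemma equivb_sound c1 c0 ws fl : isolates1 pts c0 -> equivb pts lin c1 c0 ws fl ->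
  exists2 g, automorphism g & forall v, get c1 (g v) = get c0 v.
Proof.
rewrite /isolates1 everyE => /allP iso1; elim: fl ws => [|vs fl IH] ws /=; last first.
  by rewrite someE => /hasP[w _]; case: ifP => // _ /IH.
rewrite /agree everyE => /allP ag; have agE v : get c1 (lin ws v) = get c0 v.
  by have := ag v (mem_pts v); rewrite eqnE => /eqP.
have l1 : lin ws 1 = 1 by have := linM ws 1 1; rewrite !mulgV.
exists (lin ws) => //; split=> //; apply: injF_bij => v w vw.
(* If two points have the same image, their quotient is sent to 1; it has the colour of 1, which is
   isolated. *)
have := iso1 (v * w^-1) (mem_pts _); rewrite eqnE -agE linM vw mulgV -[in get c1 _]l1 agE eqxx.
by rewrite -eq_mulgV1 => /eqP.
Qed.

Section Invariant.
Variable C : finType.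

(** [inv_basic] and [inv_bound] say what the two kinds of status assert; [inv_pair] keeps each block
    of the second phase inside one symmetrized class. Statuses are stated for [col] only, and
    [inv_sym] transfers them to [col']. *)
Record inv sym (c : tab nat) (s : tab (option nat)) (col col' : T -> C) : Prop := Inv {
  inv_link : linked col col';
  inv_col : forall z z', kol sym col z = kol sym col' z' -> get c z = get c z';
  inv_pair : ~~ sym -> forall v w, get c v = get c w -> kol true col v = kol true col w;
  inv_basic : forall v w, get s v = None -> get c w = get c v -> kol sym col w = kol sym col v;
  inv_bound : forall v m, get s v = Some m -> m <= #|[set w | kol sym col w == kol sym col v]|;
  inv_stat : forall v w, get c v = get c w -> get s v = get s w
}.

Lemma inv_self sym c s col col' : inv sym c s col col' ->
  forall z z', kol sym col z = kol sym col z' -> get c z = get c z'.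
Proof.
move=> I z z' zz'; have [y yz'] := linked_l (inv_link I) z'.
have e := col_kol sym (inv_link I) yz'.
by rewrite (inv_col I e) (inv_col I (etrans zz' e)).
Qed.

Lemma inv_finer sym c c' s col col' : inv sym c s col col' ->
  (forall z z', kol sym col z = kol sym col' z' -> get c' z = get c' z') ->
  (forall v w, get c' v = get c' w -> get c v = get c w) -> inv sym c' s col col'.
Proof.
case=> L c1 c2 c3 c4 c5 ck fin; split=> //.
- by move=> ns v w /fin; exact: c2.
- by move=> v w sv /fin; exact: c3.
by move=> v w /fin; exact: c5.
Qed.

Lemma inv_sym sym c s col col' : inv sym c s col col' -> inv sym c s col' col.
Proof.
move=> I; have [L c1 c2 c3 c4 c5] := I.
have L' := linked_sym L; have K := col_kol sym L; have K' := col_kol sym L'.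
split=> // [z z' /esym/c1->//|ns v w vw|v w sv wv|v m sv].
- have [x vx] := linked_l L' v; have [y wy] := linked_l L' w.
  rewrite (col_kol true L' vx) (col_kol true L' wy); apply: c2 => //.
  by rewrite (c1 x v) ?(c1 y w) //; exact/esym/K'.
- have [x vx] := linked_l L' v; have [y wy] := linked_l L' w.
  have xv : get c x = get c v by apply/c1/esym/K'.
  have yw : get c y = get c w by apply/c1/esym/K'.
  by rewrite (K' _ _ vx) (K' _ _ wy); apply: c3; rewrite ?yw ?xv // (c5 _ _ xv).
have [x vx] := linked_l L' v; rewrite (K' _ _ vx) -(linked_card_class _ (linked_kol abT sym L)).
by apply: c4; rewrite (c5 x v) //; apply/c1/esym/K'.
Qed.

Lemma class_candidate sym c s col col' u w : inv sym c s col col' ->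
  get c w = get c u -> kol sym col w <> kol sym col u ->
  exists l, [/\ l \in cands tsub pts sym (block c (get c u)), uniq l &
    forall x, (x \in l) = (kol sym col x == kol sym col u)].
Proof.
move=> I wu nwu; have L := linked_self (inv_link I); have cself := inv_self I.
have xV x : x \in block c (get c u) ->
    x^-1 \in block c (get c u) /\
    (kol sym col x^-1 == kol sym col u) =
      (if sym then kol sym col x == kol sym col u else kol sym col x != kol sym col u).
  rewrite !mem_block => /eqP xu.
  have [s1|ns] : sym \/ sym = false by case: (sym); [left|right].
    by have xx := kolV col x s1; rewrite (cself _ _ xx) xu eqxx xx s1.
  have p2 y : get c y = get c u -> col y = col u \/ col y = col u^-1.
    move/(inv_pair I (negbT ns)) => /setP/(_ (col y)); rewrite /= set21 => /esym/set2P[]; auto.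
  have kE y z : (kol sym col y == kol sym col z) = (col y == col z).
    rewrite /kol ns; apply/eqP/eqP => [/setP/(_ (col y))|->//].
    by rewrite set11 => /esym/set1P.
  (* In the second phase the block has only the colours of [u] and [u^-1]. As [w] lacks the first,
     the two differ and inversion swaps them. *)
  have wu' : col w = col u^-1 by case: (p2 w wu) => // e; case: nwu; apply/eqP; rewrite kE e.
  have uV : col u^-1 != col u by rewrite -wu' -kE; apply/eqP.
  rewrite !kE [in if _ then _ else _]ns; case: (p2 x xu) => e.
    have eV : col x^-1 = col u^-1 by exact: (linkedV L).
    rewrite eV (negPf uV) e eqxx; split=> //; rewrite -wu; apply/eqP/cself/eqP.
    by rewrite kE wu' eV.
  have eV : col x^-1 = col u by rewrite (linkedV L e) invgK.
  rewrite eV eqxx e uV; split=> //; apply/eqP/cself/eqP.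
  by rewrite kE eV.
have [||l [lc ul lP]] := cands_complete (sym := sym) (B := block c (get c u))
    (P := fun x => kol sym col x == kol sym col u) (uniq_block _ _).
- by move=> x /xV[].
- by move=> x /xV[_ ->].
exists l; split=> // x; rewrite lP mem_block; apply: andb_idl => /eqP xu.
by rewrite (cself _ _ xu).
Qed.

(** Recolouring a class and its partner gives one function of the colours [kol] on both sides, hence
    equal keys. *)
Lemma keyed_class sym c s col col' u u' l l' lo hi : inv sym c s col col' ->
  kol sym col u = kol sym col' u' -> uniq l -> uniq l' ->
  (forall x, (x \in l) = (kol sym col x == kol sym col u)) ->
  (forall x, (x \in l') = (kol sym col' x == kol sym col' u')) ->
  lo <= size l <= hi ->
  exists k c1 c1', [/\ keyed tsub c (ncol c) lo hi l = Some (k, c1),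
    keyed tsub c (ncol c) lo hi l' = Some (k, c1'),
    forall x, get c1 x = if x \in l then ncol c else get c x,
    forall x, get c1' x = if x \in l' then ncol c else get c x &
    forall z z', kol sym col z = kol sym col' z' -> get c1 z = get c1' z'].
Proof.
move=> I uu' ul ul' lP l'P lohi; have L := linked_kol abT sym (inv_link I).
have szE : size l' = size l.
  by rewrite (size_card ul lP) (size_card ul' l'P) -uu' (linked_card_class _ L).
pose rc l0 := foldr (fun x (t : tab nat) => put t x (ncol c)) c l0.
have [F [cF cF']] := factor_colouring L (inv_col I).
pose F1 i := if i == kol sym col u then ncol c else F i.
have F1E v : get (rc l) v = F1 (kol sym col v) by rewrite get_recolour lP /F1 cF.
have F1E' v : get (rc l') v = F1 (kol sym col' v) by rewrite get_recolour l'P /F1 cF' uu'.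
have pr z z' : z \in l -> z' \in l' -> profile (rc l) l z = profile (rc l') l' z'.
  rewrite lP l'P => /eqP zu /eqP zu'.
  apply: (profile_linked (P := fun i => i == kol sym col u) L F1E F1E') => //.
  - by move=> x; rewrite l'P uu'.
  by rewrite zu zu'.
have [x xl] : exists x, x \in l by exists u; rewrite lP.
have [x' xl'] : exists x, x \in l' by exists u'; rewrite l'P.
have hd (l0 : seq T) y k : y \in l0 -> lo <= size l0 <= hi ->
    (forall z, z \in l0 -> profile (rc l0) l0 z = k) ->
    keyed tsub c (ncol c) lo hi l0 = Some (k, rc l0).
  rewrite /keyed => yl0 -> kk; case: l0 yl0 kk => // z l0 _ kk.
  rewrite everyE (_ : all _ _); first by rewrite kk ?mem_head.
  apply/allP => t tl; rewrite (sameP (e := eqn)) => [|i j]; last by rewrite eqnE.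
  by rewrite !kk // ?mem_head // inE tl orbT.
exists (profile (rc l) l x), (rc l), (rc l'); split.
- by apply: (hd _ x) => // z zl; rewrite (pr x x') // (pr z x').
- by apply: (hd _ x'); rewrite ?szE // => z zl; rewrite (pr x z).
- by move=> z; rewrite get_recolour.
- by move=> z; rewrite get_recolour.
by move=> z z' zz'; rewrite F1E F1E' zz'.
Qed.

Lemma keyed_get c r lo hi l k (c1 : tab nat) : keyed tsub c r lo hi l = Some (k, c1) ->
  forall x, get c1 x = if x \in l then r else get c x.
Proof.
rewrite /keyed; case: ifP => // _; case: l => // y l; case: ifP => // _ [_ <-] x.
exact: (get_recolour c r (y :: l)).
Qed.

Lemma solve_sound sym (leaf : tab nat -> bool) :
  (forall c (col col' : T -> C), leaf c -> linked col col' ->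
     (forall z z', kol sym col z = kol sym col' z' -> get c z = get c z') ->
     (forall v w, get c v = get c w -> kol sym col v = kol sym col w) -> same_upto col col') ->
  forall n c s (col col' : T -> C), solve tsub pts lin flag sym leaf n c s ->
    inv sym c s col col' -> same_upto col col'.
Proof.
move=> leafP; elim=> //= n IHn c s col col' + I; have L := inv_link I.
case def_U: [seq v <- pts | get s v] => [|v vs].
  move/leafP; apply=> // [|v w vw]; first exact: inv_col I.
  have sv x : get s x = None.
    have : x \notin [seq v <- pts | get s v] by rewrite def_U.
    by rewrite mem_filter mem_pts andbT; case: (get s x).
  exact: (inv_basic I).
set v0 := foldr _ v vs.
have sv0 : get s v0.
  have : v0 \in [seq v <- pts | get s v] by rewrite def_U foldr_select.
  by rewrite mem_filter => /andP[].
move: v0 sv0 => {v vs def_U} v0; case def_m: (get s v0) => [m|] //= _.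
set i := get c v0; set B := block c i; set K := if m.*2 <= _ then _ else _.
rewrite everyE; case: ifP => // /allP chk.
have csub u : get c u = i -> {subset [pred x | kol sym col x == kol sym col u] <= B}.
  by move=> ui x /eqP xu; rewrite mem_block -ui (inv_self I xu).
have sB : size B = #|[set x | x \in B]| by apply: size_card => //; exact: uniq_block.
have cle u : get c u = i -> #|[set x | kol sym col x == kol sym col u]| <= size B.
  by move=> /csub cu; rewrite sB; apply/subset_leq_card/subsetP => x; rewrite !inE => /cu.
(* If the block is one class, the search goes on with its status set to [None]. *)
have [one|] := boolP [forall w, (get c w == i) ==> (kol sym col w == kol sym col v0)].
  have -> : size B < m = false.
    by apply/negbTE; rewrite -leqNgt (leq_trans (inv_bound I def_m)) ?cle.
  move/IHn; apply; have [_ c1 c2 c3 c4 c5] := I.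
  have oneE w : get c w = i -> kol sym col w = kol sym col v0.
    by move=> wi; have /forallP/(_ w) := one; rewrite wi eqxx => /eqP.
  split=> // [x y|x k|x y xy]; rewrite ?get_mk ?eqnE.
  - by case: eqP => [xi _ yx|_ sx yx]; [rewrite !oneE // yx|exact: c3].
  - by case: eqP => // _; exact: c4.
  by rewrite xy (c5 _ _ xy).
rewrite negb_forall => /existsP[w0]; rewrite negb_imply => /andP[/eqP w0i /eqP w0v0].
pose cs x := #|[set w | kol sym col w == kol sym col x]|.
(* The class of [u] is smallest in the block; another class there is at least as large, so it fills
   at most half of the block. *)
case: (arg_minnP (P := fun x => get c x == i) cs (eqxx _ : get c v0 == i)) => u /eqP ui umin.
have [w1 w1i w1u] : exists2 w, get c w = i & kol sym col w <> kol sym col u.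
  have [e|] := eqVneq (kol sym col v0) (kol sym col u); first by exists w0; rewrite // -e.
  by move/eqP => ne; exists v0.
have csB : (cs u).*2 <= size B.
  have := umin w1; rewrite w1i eqxx => /(_ isT) uw.
  rewrite -addnn (leq_trans (leq_add (leqnn _) uw)) // /cs -cardsUI.
  rewrite (_ : _ :&: _ = set0) ?cards0 ?addn0; last first.
    by apply/setP=> x; rewrite !inE; apply/negP => /andP[/eqP-> /eqP e]; case: w1u.
  rewrite sB; apply/subset_leq_card/subsetP => x; rewrite !inE.
  by case/orP => xx; [apply: (csub _ ui)|apply: (csub _ w1i)].
have mcs : m <= cs u by apply: (inv_bound I); rewrite (inv_stat I (w := v0)).
have [u' uu0] := linked_l L u; have uu' := col_kol sym L uu0.
have [w1' ww0] := linked_l L w1; have ww' := col_kol sym L ww0.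
have u'i : get c u' = i by rewrite -(inv_col I uu').
have w1'i : get c w1' = i by rewrite -(inv_col I ww').
have [|l [lc ul lP]] := class_candidate I (u := u) (w := w1) _ w1u; first by rewrite w1i ui.
have [||l' [lc' ul' l'P]] := class_candidate (inv_sym I) (u := u') (w := w1').
- by rewrite w1'i.
- by rewrite -uu' -ww'.
rewrite ui in lc; rewrite u'i in lc'.
have szl : size l = cs u by exact: size_card.
have lohi : m <= size l <= (size B)./2.
  by rewrite szl mcs /= -[X in X <= _](doubleK (cs u)) half_leq.
have [k [c1 [c1' [kl kl' c1E c1E' c1k]]]] := keyed_class I uu' ul ul' lP l'P lohi.
have KE : K = pmap (keyed tsub c (ncol c) m (size B)./2) (cands tsub pts sym B).
  by rewrite /K (leq_trans _ csB) // leq_double.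
have := chk k; rewrite mem_undup KE (mem_keys lc kl) => /(_ isT) /=.
case def_G: [seq _ | _ <- _ & _] => [|c0 G].
  have /all_keyed : all xpred0 [seq x.2 | x <- pmap (keyed tsub c (ncol c) m (size B)./2)
    (cands tsub pts sym B) & x.1 == k] by rewrite def_G.
  by move=> /(_ _ _ lc kl).
have [l0 l0c kl0] := head_keyed def_G.
rewrite -def_G; case: ifP => // iso; rewrite everyE; case: ifP => // /all_keyed eqvG.
(* Both candidates share their key with the representative [c0]; pulling back along [g] and [g']
   makes [c0] coarser than both colourings. *)
have [g ag gE] := equivb_sound iso (eqvG _ _ lc kl).
have [g' ag' g'E] := equivb_sound iso (eqvG _ _ lc' kl').
have c0E := keyed_get kl0.
(* Undoing the fresh colour recovers [c] from each recoloured table, so [g] preserves [c]. *)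
pose forget j := if j == ncol c then i else j.
have forgetE (l2 : seq T) (c2 : tab nat) : {subset l2 <= B} ->
    (forall x, get c2 x = if x \in l2 then ncol c else get c x) ->
    forall x, get c x = forget (get c2 x).
  move=> l2B c2E x; rewrite /forget c2E; have [/l2B|_] := boolP (x \in l2).
    by rewrite mem_block eqxx => /eqP.
  by rewrite ltn_eqF // get_lt_ncol.
have lB : {subset l <= B} by move=> x; rewrite lP; exact: (csub _ ui).
have f0 := forgetE _ _ (cands_sub l0c) c0E; have f1 := forgetE _ _ lB c1E.
have cg v : get c (g v) = get c v by rewrite f1 gE -f0.
have c1r x : (get c1 x == ncol c) = (x \in l).
  by rewrite c1E; case: ifP => _; rewrite ?eqxx // ltn_eqF // get_lt_ncol.
have sz : size (block c0 (ncol c)) = cs u.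
  rewrite (size_card (P := fun x => g x \in l)) ?uniq_block // => [|x].
    rewrite -szl (size_card (P := mem l) ul) // -[RHS](on_card_preimset (f := g)).
      by apply: eq_card => x; rewrite !inE.
    by case: ag => -[h gK hK] _; exists h => x _; rewrite ?gK ?hK.
  by rewrite mem_block -gE c1r.
rewrite sz; set s' := mk _.
have kg v : kol sym (col \o g) v = kol sym col (g v) by exact: kol_automorphism.
have kg' v : kol sym (col' \o g') v = kol sym col' (g' v) by exact: kol_automorphism.
have bij_class v : #|[set w | kol sym (col \o g) w == kol sym (col \o g) v]| = cs (g v).
  rewrite /cs -[RHS](on_card_preimset (f := g)); last first.
    by case: ag => -[h gK hK] _; exists h => x _; rewrite ?gK ?hK.
  by apply: eq_card => x; rewrite !inE !kg.
have I0 : inv sym c0 s' (col \o g) (col' \o g').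
  split.
  - exact: linked_automorphism.
  - by move=> z z'; rewrite kg kg' -gE -g'E; exact: c1k.
  - move=> ns v w vw; have kt x : kol true (col \o g) x = kol true col (g x).
      exact: kol_automorphism.
    rewrite !kt; apply: (inv_pair I ns).
    by rewrite !cg f0 vw -f0.
  - move=> v w; rewrite get_mk eqnE !kg => + wv.
    have cwv : get c w = get c v by rewrite f0 wv -f0.
    case: eqP => [vi|_ sv].
      case: eqP => // v0r _.
      have : get c0 w == ncol c by rewrite wv v0r.
      rewrite -gE c1r lP => /eqP->; apply/esym/eqP; rewrite -lP -c1r gE.
      exact/eqP.
    by apply: (inv_basic I); rewrite ?cg // (inv_stat I (cg v)).
  - move=> v m'; rewrite bij_class get_mk eqnE.
    case: eqP => [vi|_ sv]; last by apply: (inv_bound I); rewrite (inv_stat I (cg v)).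
    case: eqP => // _ [<-]; apply: umin; rewrite cg; exact/eqP.
  move=> v w vw; have cvw : get c v = get c w by rewrite f0 vw -f0.
  by rewrite !get_mk vw cvw (inv_stat I cvw).
have := refine_sound (linked_kol abT sym (inv_link I0)) n (inv_col I0) (inv_basic I0).
case: refine => // c2 [ck fin] /IHn/(_ (inv_finer I0 ck fin)).
by move/(same_upto_comp ag ag').
Qed.

End Invariant.
End SearchSound.

(** * The two phases, and the search over C_2^3 and C_3^3 *)

Section TwoPhases.
Variables (T : finGroupType) (tsub : T -> T -> T) (pts : seq T) (tb : tabling T).
Variables (lin : seq T -> T -> T) (flag : seq (seq T)) (fuel : nat).
Local Notation solve := (solve tsub pts lin flag).

(** It starts from the symmetrized classes. At a leaf the blocks are the classes of both colourings,
    which then coincide, so nothing is left to test. *)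
Definition second_phase (c : tab tb nat) :=
  solve false (fun _ => true) fuel c
    (mk tb (fun v => if size (block pts c (get c v)) == 1%N then None else Some 1%N)).

Definition first_phase :=
  solve true second_phase fuel (mk tb (fun v => if v == 1 then 0%N else 1%N))
    (mk tb (fun v => if v == 1 then None else Some 1%N)).

Hypothesis abT : abelian [set: T].
Hypothesis tsubE : forall x y, tsub x y = x * y^-1.
Hypothesis mem_pts : forall x, x \in pts.
Hypothesis uniq_pts : uniq pts.
Hypothesis linM : forall ws x y, lin ws (x * y^-1) = lin ws x * (lin ws y)^-1.

Lemma kol_falseP (C : finType) (col col' : T -> C) v w :
  kol false col v = kol false col' w -> col v = col' w.
Proof. by move/setP/(_ (col v)); rewrite set11 => /esym/set1P. Qed.

Lemma second_phase_sound (C : finType) c (col col' : T -> C) :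
  second_phase c -> linked col col' ->
  (forall z z', kol true col z = kol true col' z' -> get c z = get c z') ->
  (forall v w, get c v = get c w -> kol true col v = kol true col w) -> same_upto col col'.
Proof.
move=> sol L ck kc; apply: (solve_sound abT tsubE mem_pts uniq_pts linM _ sol).
  move=> d k k' _ Lk dk kd; exists id => [|v]; first by split; first exists id.
  have [w wv] := linked_r Lk v; have e := dk _ _ (col_kol false Lk wv).
  by rewrite -wv; exact/kol_falseP/kd.
split=> // [z z' /kol_falseP e|v w|v m|v w vw]; rewrite ?get_mk.
- exact/ck/col_kol.
- case: eqP => // /eqP s1 _ wv; suff -> : w = v by [].
  have wB : w \in block pts c (get c v) by rewrite mem_block // wv.
  have vB : v \in block pts c (get c v) by rewrite mem_block.
  case: block s1 wB vB => [|x [|y s]] //= _; rewrite !inE => /eqP-> /eqP->; done.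
- case: eqP => // _ [<-]; apply/card_gt0P; exists v; rewrite inE; exact: eqxx.
by rewrite vw.
Qed.

Lemma first_phase_sound (C : finType) (col col' : T -> C) :
  first_phase -> linked col col' -> same_upto col col'.
Proof.
move=> sol L; apply: (solve_sound abT tsubE mem_pts uniq_pts linM _ sol).
  exact: second_phase_sound.
have L1 := linked1 (linked_kol abT true L).
split=> // [z z' /L1 zz'|v w|v m|v w].
- by rewrite !get_mk zz'.
- by rewrite !get_mk; case: (v =P 1) => // ->; case: (w =P 1) => // ->.
- rewrite get_mk; case: eqP => // _ [<-]; apply/card_gt0P; exists v; rewrite inE; exact: eqxx.
by rewrite !get_mk; do 2!case: eqP.
Qed.
End TwoPhases.

Section Cube.
Variables (D : finGroupType) (digits : seq D) (dtab : tabling D).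
Variables (dadd dsub dmul : D -> D -> D).
Local Notation cube := (D * D * D)%type.

Definition cube_add (x y : cube) : cube :=
  let: (a, b, c) := x in let: (d, e, f) := y in (dadd a d, dadd b e, dadd c f).
Definition cube_scale t (x : cube) : cube :=
  let: (a, b, c) := x in (dmul t a, dmul t b, dmul t c).
Definition cube_lin ws (x : cube) : cube :=
  let: (a, b, c) := x in
  match ws with
  | [:: u] => cube_scale a u
  | [:: u; v] => cube_add (cube_scale a u) (cube_scale b v)
  | [:: u, v, w & _] => cube_add (cube_scale a u) (cube_add (cube_scale b v) (cube_scale c w))
  | [::] => 1
  end.

Definition cube_flag : seq (seq cube) :=
  let nz := [seq d <- digits | d != 1] in
  [:: [seq (a, 1, 1) | a <- nz]; [seq (a, b, 1) | b <- nz, a <- digits];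
      [seq (x, c) | c <- nz, x <- [seq (a, b) | a <- digits, b <- digits]]].

Definition cube_search fuel :=
  first_phase (cube_sub dsub) (cube_pts digits) (prod_tab (prod_tab dtab dtab) dtab)
    cube_lin cube_flag fuel.
End Cube.

Section CubeSound.
Variables (D : finGroupType) (digits : seq D) (dtab : tabling D).
Variables (dadd dsub dmul : D -> D -> D).
Hypothesis mem_digits : forall d, d \in digits.
Hypothesis uniq_digits : uniq digits.
Hypothesis daddE : forall a b, dadd a b = a * b.
Hypothesis dsubE : forall a b, dsub a b = a * b^-1.
Hypothesis dmulBl : forall a b d, dmul (a * b^-1) d = dmul a d * (dmul b d)^-1.
Hypothesis abD : abelian [set: D].
Local Notation cube := (D * D * D)%type.

Lemma cube_abelian : abelian [set: cube].
Proof.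
apply/centsP => -[[a b] c] _ [[d e] f] _.
by congr (_, _, _); exact: abelian_mulgC.
Qed.

Lemma cube_addE (x y : cube) : cube_add dadd x y = x * y.
Proof. by case: x y => [[a b] c] [[d e] f]; rewrite /= !daddE. Qed.

Lemma cube_scaleB a b (x : cube) :
  cube_scale dmul (a * b^-1) x = cube_scale dmul a x * (cube_scale dmul b x)^-1.
Proof. by case: x => [[d e] f]; rewrite /= !dmulBl. Qed.

Lemma cube_linB ws (x y : cube) :
  cube_lin dadd dmul ws (x * y^-1) = cube_lin dadd dmul ws x * (cube_lin dadd dmul ws y)^-1.
Proof.
have mulC := abelian_mulgC cube_abelian.
have AC (a b c d : cube) : (a * b^-1) * (c * d^-1) = (a * c) * (b * d)^-1.
  by rewrite invMg -!mulgA; congr (_ * _); rewrite !mulgA [RHS]mulC !mulgA mulC !mulgA.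
case: x y => [[a b] c] [[d e] f]; case: ws => [|u [|v [|w ws]]] /=.
- by rewrite mulgV.
- exact: cube_scaleB.
- by rewrite !cube_addE !cube_scaleB AC.
by rewrite !cube_addE !cube_scaleB !AC.
Qed.

Lemma cube_pts_uniq : uniq (cube_pts digits).
Proof. by do 2!(apply: allpairs_uniq => //; last by move=> [? ?] [? ?] _ _ [-> ->]). Qed.

Lemma cube_search_sound fuel (C : finType) (col col' : cube -> C) :
  cube_search digits dtab dadd dsub dmul fuel -> linked col col' -> same_upto col col'.
Proof.
move=> sol; apply: (first_phase_sound cube_abelian (cube_subE dsubE) _ cube_pts_uniq cube_linB sol).
exact: mem_cube_pts.
Qed.

End CubeSound.

Inductive triple (A : Type) := Triple of A & A & A.
Definition triple_get A (t : triple A) x :=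
  let: Triple a b c := t in match x with T0 => a | T1 => b | T2 => c end.
Definition triple_mk A (f : trit -> A) := Triple (f T0) (f T1) (f T2).
Definition triple_put A (t : triple A) x y :=
  let: Triple a b c := t in
  match x with T0 => Triple y b c | T1 => Triple a y c | T2 => Triple a b y end.
Fact triple_get_mk A (f : trit -> A) x : triple_get (triple_mk f) x = f x. Proof. by case: x. Qed.
Fact triple_get_put A (t : triple A) x a y :
  triple_get (triple_put t x a) y = if y == x then a else triple_get t y.
Proof. by case: t; case: x; case: y. Qed.
Definition trit_tab : tabling trit := @Tabling trit triple _ _ _ triple_get_mk triple_get_put.

Definition bool_get A (t : A * A) (x : bool) := let: (a, b) := t in if x then b else a.
Definition bool_mk A (f : bool -> A) := (f false, f true).
Definition bool_put A (t : A * A) x y := let: (a, b) := t in if x then (a, y) else (y, b).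
Fact bool_get_mk A (f : bool -> A) x : bool_get (bool_mk f) x = f x. Proof. by case: x. Qed.
Fact bool_get_put A (t : A * A) x a y :
  bool_get (bool_put t x a) y = if y == x then a else bool_get t y.
Proof. by case: t; case: x; case: y. Qed.
Definition bool_tab : tabling bool :=
  @Tabling bool (fun A => A * A)%type _ _ _ bool_get_mk bool_get_put.

Lemma trit_search : cube_search [:: T0; T1; T2] trit_tab trit_add trit_sub trit_mul 40.
Proof. by vm_compute. Qed.
Lemma bool_search : cube_search [:: false; true] bool_tab addb addb andb 40.
Proof. by vm_compute. Qed.

Lemma trit_same_upto (C : finType) (col col' : trit * trit * trit -> C) :
  linked col col' -> same_upto col col'.
Proof.
apply: (cube_search_sound _ _ _ _ _ _ trit_search) => //; try by do ?case.
by apply/centsP => x _ y _; case: x; case: y.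
Qed.

Lemma bool_same_upto (C : finType) (col col' : bool * bool * bool -> C) :
  linked col col' -> same_upto col col'.
Proof.
apply: (cube_search_sound _ _ _ _ _ _ bool_search) => //; try by do ?case.
by apply/centsP => x _ y _; case: x; case: y.
Qed.

(** Transported to [T] by codings, the two colourings differ by an automorphism [g]; decoding, [g]
    and coding compose to the isomorphism. *)
Lemma separable_of_coding (T gT : finGroupType) : abelian [set: T] -> abelian [set: gT] ->
  (forall (C : finType) (col col' : T -> C), linked col col' -> same_upto col col') ->
  (forall (C : finType) (gT' : finGroupType) (col : gT -> C) (col' : gT' -> C),
     abelian [set: gT'] -> linked col col' -> exists dec : T -> gT', coding col' dec) ->
  separable_group abelian_groups gT.
Proof.
move=> abT abG uptoT codes A gT' A' phi abG' iso; have L := alg_iso_linked iso.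
have [dec cd] := codes _ _ _ _ abG (linked_self L).
have [dec' cd'] := codes _ _ _ _ abG' L.
have [g [bg gB] gE] := uptoT _ _ _ (linked_coding abT abG abG' L cd cd').
case: cd cd' => -[e dK eK] decB [bd' decB'].
exists (dec' \o g \o e); apply: (colour_iso_induced iso) => [|x y /=].
  by apply: bij_comp; [exact: bij_comp | exists dec].
rewrite -decB' -gB -[y in RHS]eK -[x in RHS]eK -(decB (e y) (e x)).
exact: gE.
Qed.

Lemma separable_elementary p (gT : finGroupType) : p = 2 \/ p = 3 ->
  abelian [set: gT] -> (forall x : gT, x ^+ p = 1) -> #|gT| = (p ^ 3)%N ->
  separable_group abelian_groups gT.
Proof.
move=> pE abG expG cG; case: pE expG cG => -> expG cG.
  apply: separable_of_coding bool_same_upto _ => //.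
    by apply: cube_abelian; apply/centsP => x _ y _; case: x; case: y.
  by move=> C gT' col col' abG'; apply: bool_coding.
apply: separable_of_coding trit_same_upto _ => //.
  by apply: cube_abelian; apply/centsP => x _ y _; case: x; case: y.
by move=> C gT' col col' abG'; apply: trit_coding.
Qed.

Lemma pair_expg (gT hT : finGroupType) (x : gT) (y : hT) n : (x, y) ^+ n = (x ^+ n, y ^+ n).
Proof. by elim: n => // n IHn; rewrite !expgS IHn. Qed.

Lemma Zp_abelianT n : abelian [set: 'I_n.+1].
Proof. by apply/centsP => x _ y _; exact: Zp_mulgC. Qed.

Lemma Zp_expg n (x : 'I_n.+1) : x ^+ n.+1 = 1.
Proof. by rewrite -[n.+1]card_ord -cardsT expg_cardG ?inE. Qed.

Lemma separable_Zp p : p = 2 \/ p = 3 ->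
  separable_group abelian_groups ('Z_p * 'Z_p * 'Z_(p ^ 1))%type.
Proof.
move=> pE; apply: (separable_elementary pE).
- by apply: pair_abelian; [apply: pair_abelian|]; exact: Zp_abelianT.
- by case: pE => -> [[a b] c]; rewrite !pair_expg !Zp_expg.
by case: pE => ->; rewrite !card_prod !card_ord.
Qed.

(** * Non-separable groups *)

Section Scale.
Variables (p k : nat).
Hypothesis p1 : 1 < p.

(** Embeds C_(p^2) as the subgroup of multiples of [p ^ k]. *)
Definition Zp_scale (c : 'Z_(p ^ 2)) : 'Z_(p ^ k.+2) := inZp (p ^ k * c).

Let modulusE : (Zp_trunc (p ^ k.+2)).+2 = (p ^ k * (Zp_trunc (p ^ 2)).+2)%N.
Proof.
rewrite !Zp_cast ?(ltn_exp2r 1) -?expnD ?addn2 //.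
  by rewrite -(exp1n 2) ltn_exp2r.
by rewrite -(exp1n k.+2) ltn_exp2r.
Qed.

Lemma Zp_scaleM : {morph Zp_scale : a b / a * b}.
Proof.
move=> a b; apply: val_inj; rewrite /= modnDm -mulnDr modulusE.
by rewrite -!muln_modr modn_mod.
Qed.

Lemma Zp_scale_inj : injective Zp_scale.
Proof.
move=> a b /(congr1 val) /=; rewrite modulusE -!muln_modr => /eqP.
by rewrite eqn_pmul2l ?expn_gt0 ?(ltnW p1) // !modn_small // => /eqP/val_inj.
Qed.
End Scale.

(** * Extending a colouring from a subgroup *)

Section Extension.
Variables (C : finType) (T G : finGroupType) (iota : T -> G) (col : T -> C).
Hypotheses (iotaM : {morph iota : x y / x * y}) (iotaI : injective iota).

Definition extend g : option C := omap col [pick x | iota x == g].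

Lemma morph_mulg1 : iota 1 = 1.
Proof. by apply: (mulgI (iota 1)); rewrite -iotaM !mulg1. Qed.

Lemma morph_mulgV x : iota x^-1 = (iota x)^-1.
Proof. by apply: (mulgI (iota x)); rewrite -iotaM !mulgV morph_mulg1. Qed.

Lemma extendE x : extend (iota x) = Some (col x).
Proof.
rewrite /extend; case: pickP => [y /eqP/iotaI->//|/(_ x)].
by rewrite eqxx.
Qed.

Lemma extend_Some g c : extend g = Some c -> exists2 x, g = iota x & col x = c.
Proof. by rewrite /extend; case: pickP => //= x /eqP <- [<-]; exists x. Qed.

Lemma extend_None g : extend g = None <-> forall x, g != iota x.
Proof.
split=> [gN x|ng]; first by apply: contra_eqN gN => /eqP->; rewrite extendE.
by case e: (extend g) => [c|//]; have [x gx] := extend_Some e; case/eqP: (ng x).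
Qed.

Lemma extend_classSome i : #|[set g | extend g == Some i]| = #|[set x | col x == i]|.
Proof.
rewrite -(card_imset [set x | col x == i] iotaI); apply: eq_card => g; rewrite inE.
apply/eqP/imsetP => [/extend_Some[x -> xi]|[x]]; first by exists x; rewrite ?inE ?xi.
by rewrite inE => /eqP <- ->; rewrite extendE.
Qed.

Lemma extend_classNone : #|[set g | extend g == None]| = #|G| - #|T|.
Proof.
rewrite -(card_codom iotaI) -(cardC [in codom iota]) addKn; apply: eq_card => g; rewrite !inE.
apply/eqP/idP => [/extend_None ng|ng]; last first.
  by apply/extend_None => x; apply: contraNneq ng => ->; exact: codom_f.
by apply/negP => /codomP[x gx]; have := ng x; rewrite gx eqxx.
Qed.

Lemma extend_npairs i j z : npairs extend (Some i) (Some j) (iota z) = npairs col i j z.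
Proof.
rewrite /npairs -[RHS](card_imset _ iotaI); apply: eq_card => g; rewrite inE.
apply/andP/imsetP => [[/eqP/extend_Some[x -> xi]]|[x]].
  by rewrite -morph_mulgV -iotaM extendE => jz; exists x; rewrite ?inE ?xi ?eqxx.
by rewrite inE => /andP[/eqP xi jz] ->; rewrite -morph_mulgV -iotaM !extendE xi.
Qed.

Lemma extend_npairs0 i j g : extend g = None -> npairs extend (Some i) (Some j) g = 0%N.
Proof.
move/extend_None => ng; apply/eqP; rewrite cards_eq0; apply/eqP/setP=> h; rewrite !inE.
apply/negP => /andP[/eqP/extend_Some[x hx _] /eqP/extend_Some[y hy _]].
by have := ng (x * y); rewrite iotaM -hx -hy mulKVg eqxx.
Qed.

End Extension.

Section LinkedExtension.
Variables (C : finType) (T G T' G' : finGroupType).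
Variables (iota : T -> G) (iota' : T' -> G') (col : T -> C) (col' : T' -> C).
Hypotheses (iotaM : {morph iota : x y / x * y}) (iotaI : injective iota).
Hypotheses (iotaM' : {morph iota' : x y / x * y}) (iotaI' : injective iota').
Hypotheses (cG : #|G| = #|G'|) (L : linked col col').
Local Notation ext := (extend iota col).
Local Notation ext' := (extend iota' col').

Lemma extend_class c : #|[set g | ext g == c]| = #|[set g | ext' g == c]|.
Proof.
case: c => [i|]; last by rewrite !extend_classNone // cG (linked_card L).
by rewrite !extend_classSome // (linked_card_class _ L).
Qed.

(** With both factors in the subgroup, the count reduces to [L] or is 0 outside. Counts involving
    [None] follow, because the counts with one colour fixed add up to a class size. *)
Lemma extend_npairs_linked g g' i j : ext g = ext' g' -> npairs ext i j g = npairs ext' i j g'.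
Proof.
move=> gg'; have SS i1 j1 : npairs ext (Some i1) (Some j1) g = npairs ext' (Some i1) (Some j1) g'.
  case e: (ext g) gg' => [c|] gg'; last by rewrite !extend_npairs0.
  have [x -> xc] := extend_Some e; have [y -> yc] := extend_Some (esym gg').
  by rewrite !extend_npairs //; apply: (linked_npairs L); rewrite xc yc.
have SN i1 : npairs ext (Some i1) None g = npairs ext' (Some i1) None g'.
  have := sum_npairsr ext (Some i1) g; rewrite extend_class -(sum_npairsr ext' (Some i1) g').
  rewrite (bigD1 None) // [in RHS](bigD1 None) //=.
  rewrite (eq_bigr (fun j => npairs ext' (Some i1) j g')) => [/addIn //|[j1|] _ //].
have NE j1 : npairs ext None j1 g = npairs ext' None j1 g'.
  have := sum_npairsl ext j1 g; rewrite extend_class -(sum_npairsl ext' j1 g').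
  rewrite (bigD1 None) // [in RHS](bigD1 None) //=.
  rewrite (eq_bigr (fun i => npairs ext' i j1 g')) => [/addIn //|[i1|] _ //].
  by case: j1.
by case: i => [i|//]; case: j.
Qed.

Lemma linked_extend : linked ext ext'.
Proof.
have V1 := morph_mulgV iotaM; have V1' := morph_mulgV iotaM'.
have notV (hT : finGroupType) (H : finGroupType) (f : hT -> H) (k : hT -> C) :
    {morph f : x y / x * y} -> injective f ->
    forall g, extend f k g = None -> extend f k g^-1 = None.
  move=> fM fI g /(extend_None k fI) ng; apply/(extend_None k fI) => x.
  apply: contra (ng x^-1) => /eqP e; rewrite morph_mulgV // -e invgK //.
split=> [g|g'|g g' gg'|g g' gg'|g g' i j]; last exact: extend_npairs_linked.
- have : 0 < #|[set h | ext h == ext g]| by apply/card_gt0P; exists g; rewrite inE.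
  by rewrite extend_class => /card_gt0P[g']; rewrite inE => /eqP e; exists g'.
- have : 0 < #|[set h | ext' h == ext' g']| by apply/card_gt0P; exists g'; rewrite inE.
  by rewrite -extend_class => /card_gt0P[g]; rewrite inE => /eqP e; exists g.
- case e: (ext g) gg' => [c|] gg'.
    have [x -> xc] := extend_Some e; have [y -> yc] := extend_Some (esym gg').
    rewrite -(morph_mulg1 iotaM) -(morph_mulg1 iotaM') (inj_eq iotaI) (inj_eq iotaI').
    by apply: (linked1 L); rewrite xc.
  have /(_ 1) := (extend_None col iotaI g).1 e.
  have /(_ 1) := (extend_None col' iotaI' g').1 (esym gg').
  by rewrite (morph_mulg1 iotaM) (morph_mulg1 iotaM') => /negPf-> /negPf->.
case e: (ext g) gg' => [c|] gg'; last by rewrite !notV.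
have [x -> xc] := extend_Some e; have [y -> yc] := extend_Some (esym gg').
by rewrite -V1 -V1' !extendE //; congr Some; apply: (linkedV L); rewrite xc.
Qed.

(** Dividing by [f 1] makes the map fix the identity; elements of the subgroup then keep a colour
    [Some], hence land in the subgroup. *)
Lemma extend_iso_restrict (f : G -> G') :
  (forall x y, ext' (f y * (f x)^-1) = ext (y * x^-1)) ->
  exists h : T -> T', forall x y, col' (h y * (h x)^-1) = col (y * x^-1).
Proof.
move=> fE; have hP x : exists x', iota' x' == f (iota x) * (f 1)^-1.
  have := fE 1 (iota x); rewrite invg1 mulg1 extendE // => /extend_Some[x' -> _].
  by exists x'.
pose h x := xchoose (hP x); have hE x : iota' (h x) = f (iota x) * (f 1)^-1.
  exact/eqP/(xchooseP (hP x)).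
exists h => x y; have := fE (iota x) (iota y).
rewrite -(morph_mulgV iotaM) -iotaM extendE // => e; apply: Some_inj; rewrite -e.
rewrite -(extendE col' iotaI') iotaM' (morph_mulgV iotaM') !hE.
by rewrite invMg invgK mulgA mulgKV.
Qed.

End LinkedExtension.

Lemma not_separable_extend (C : finType) (K : group_class) (T G T' G' : finGroupType)
    (iota : T -> G) (iota' : T' -> G') (col : T -> C) (col' : T' -> C) :
  {morph iota : x y / x * y} -> injective iota ->
  {morph iota' : x y / x * y} -> injective iota' -> #|G| = #|G'| ->
  linked col col' -> K G' ->
  ~ (exists h : T -> T', forall x y, col' (h y * (h x)^-1) = col (y * x^-1)) ->
  ~ separable_group K G.
Proof.
move=> iM iI iM' iI' cG L KG' noh.
apply: (not_separable_of_linked (linked_extend iM iI iM' iI' cG L) KG') => f _ fE.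
exact/noh/(extend_iso_restrict iM iI iM' iI' fE).
Qed.

(** * Computing structure constants in products of three cyclic groups *)

Lemma nth_histogram s i : nth 0 (histogram s) i = count_mem i s.
Proof. by elim: s => [|j s IHs]; rewrite ?nth_nil //= nth_incr_nth IHs. Qed.

Notation coords := (nat * nat * nat)%type.

(** Natural numbers replace ordinals for computation; [ns] lists the cyclic orders minus one. *)
Definition box (ns : coords) : seq coords :=
  let: (m, n, l) := ns in
  [seq (x, c) | x <- [seq (a, b) | a <- iota 0 m.+1, b <- iota 0 n.+1], c <- iota 0 l.+1].

Definition box_sub (ns x y : coords) : coords :=
  let: (m, n, l) := ns in let: (a, b, c) := x in let: (d, e, f) := y in
  ((a + (m.+1 - d)) %% m.+1, (b + (n.+1 - e)) %% n.+1, (c + (l.+1 - f)) %% l.+1)%N.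

Arguments box_sub : simpl never.

(** For colours at most [r], the number [(r + 1) i + j] codes the colours of the two factors, so one
    histogram holds all intersection numbers at [z]. *)
Definition box_profile r ns (col : coords -> nat) z :=
  histogram [seq (r.+1 * col h + col (box_sub ns z h))%N | h <- box ns].

Definition same_colouring_constants r ns ns' (col col' : coords -> nat) :=
  let entry ns col z :=
    (z == (0, 0, 0)%N, col z, col (box_sub ns (0, 0, 0)%N z), box_profile r ns col z) in
  let L := [seq entry ns col z | z <- box ns] in
  let L' := [seq entry ns' col' z | z <- box ns'] in
  [&& all (fun z => col z <= r) (box ns), all (fun z => col' z <= r) (box ns'),
      all (fun z => has (fun z' => col z == col' z') (box ns')) (box ns),
      all (fun z' => has (fun z => col z == col' z') (box ns)) (box ns') &
      every (fun x => every (fun x' =>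
        if eqn x.1.1.2 x'.1.1.2 then x == x' else true) L') L].

Section Box.
Variables m n l : nat.
Local Notation ns := (m, n, l).
Local Notation T := ('I_m.+1 * 'I_n.+1 * 'I_l.+1)%type.

Definition coordinates (x : T) : coords := (val x.1.1, val x.1.2, val x.2).

Lemma mem_box x : coordinates x \in box ns.
Proof.
apply: allpairs_f; last by rewrite mem_iota /= ltn_ord.
by apply: allpairs_f; rewrite mem_iota /= ltn_ord.
Qed.

Lemma box_uniq : uniq (box ns).
Proof.
by do 2!(apply: allpairs_uniq; rewrite ?iota_uniq //; last by move=> [? ?] [? ?] _ _ [-> ->]).
Qed.

Lemma coordinates_inj : injective coordinates.
Proof. by move=> [[a b] c] [[d e] f] [/val_inj-> /val_inj-> /val_inj->]. Qed.

Lemma coordinatesB h z : coordinates (h^-1 * z) = box_sub ns (coordinates z) (coordinates h).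
Proof.
case: h z => [[a b] c] [[d e] f].
have E k (x y : 'I_k.+1) : val (x^-1 * y) = (y + (k.+1 - x)) %% k.+1.
  by rewrite /= modnDml addnC.
by rewrite /coordinates /box_sub -!E.
Qed.

Lemma coordinates_surj : perm_eq (map coordinates (enum {: T})) (box ns).
Proof.
have u : uniq (map coordinates (enum {: T})) by rewrite (map_inj_uniq coordinates_inj) enum_uniq.
apply: uniq_perm => //; first exact: box_uniq.
have [|||//] := @uniq_min_size _ (map coordinates (enum {: T})) (box ns) => //.
  by move=> _ /mapP[x _ ->]; exact: mem_box.
by rewrite !size_allpairs !size_iota size_map -cardE !card_prod !card_ord.
Qed.

Variables (r : nat) (col : coords -> nat).
Hypothesis colr : forall x, x \in box ns -> col x <= r.
Let colT (x : T) : 'I_r.+1 := inord (col (coordinates x)).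

Lemma val_inord_colour x : val (colT x) = col (coordinates x).
Proof. by rewrite /= inordK // ltnS colr ?mem_box. Qed.

Lemma npairs_box_profile i j z :
  npairs colT i j z = nth 0 (box_profile r ns col (coordinates z)) (r.+1 * i + j).
Proof.
rewrite nth_histogram count_map -(seq.permP coordinates_surj) count_map -size_filter.
rewrite -(card_uniqP (filter_uniq _ (enum_uniq _))) /npairs; apply: eq_card => h.
rewrite inE mem_filter mem_enum andbT /= -coordinatesB -!val_eqE !val_inord_colour.
have := colr (mem_box h); have := colr (mem_box (h^-1 * z)).
have := ltn_ord i; have := ltn_ord j; rewrite !ltnS /=.
move: (col (coordinates h)) (col (coordinates (h^-1 * z))) (nat_of_ord i) (nat_of_ord j).
move=> a b c d dr cr br ar.
apply/andP/eqP => [[/eqP-> /eqP->]//|e].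
have ac : a = c.
  have := congr1 (fun k => k %/ r.+1) e.
  by rewrite ![(r.+1 * _)%N]mulnC !divnMDl // !divn_small ?ltnS // !addn0.
by move: e; rewrite ac => /addnI->.
Qed.
End Box.

Lemma box_linked m n l m' n' l' r (col col' : coords -> nat) :
  same_colouring_constants r (m, n, l) (m', n', l') col col' ->
  linked (fun x : 'I_m.+1 * 'I_n.+1 * 'I_l.+1 => inord (col (coordinates x)) : 'I_r.+1)
    (fun x : 'I_m'.+1 * 'I_n'.+1 * 'I_l'.+1 => inord (col' (coordinates x)) : 'I_r.+1).
Proof.
set ns := (m, n, l); set ns' := (m', n', l').
move=> /and5P[/allP cr /allP cr' /allP hl /allP hr]; rewrite everyE => /allP chk.
have E x x' : ((inord (col (coordinates x)) : 'I_r.+1) = inord (col' (coordinates x'))) <->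
    (col (@coordinates m n l x) = col' (@coordinates m' n' l' x')).
  by split=> [/(congr1 val)|->//]; rewrite (val_inord_colour cr) (val_inord_colour cr').
have z0 k1 k2 k3 (x : 'I_k1.+1 * 'I_k2.+1 * 'I_k3.+1) : (coordinates x == (0, 0, 0)%N) = (x == 1).
  by rewrite -(inj_eq (@coordinates_inj _ _ _)).
have zV k1 k2 k3 (x : 'I_k1.+1 * 'I_k2.+1 * 'I_k3.+1) :
    box_sub (k1, k2, k3) (0, 0, 0)%N (coordinates x) = coordinates x^-1.
  by rewrite -[x^-1]mulg1 coordinatesB.
have {}chk x x' : col (@coordinates m n l x) = col' (@coordinates m' n' l' x') ->
    [/\ (x == 1) = (x' == 1), col (coordinates x^-1) = col' (coordinates x'^-1) &
        box_profile r ns col (coordinates x) = box_profile r ns' col' (coordinates x')].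
  move=> xx'; have := chk _ (map_f _ (mem_box x)).
  rewrite everyE => /allP/(_ _ (map_f _ (mem_box x'))) /=.
  by rewrite eqnE xx' eqxx !z0 => /eqP[-> e ->]; split; rewrite // -!zV.
split=> [x|x'|x x' /E|x x' /E|x x' i j /E].
- have /hasP[z zB /eqP e] := hl _ (mem_box x).
  have : z \in map (@coordinates m' n' l') (enum {: _})
    by rewrite (perm_mem (coordinates_surj _ _ _)).
  by case/mapP=> y _ zy; exists y; rewrite e zy.
- have /hasP[z zB /eqP e] := hr _ (mem_box x').
  have : z \in map (@coordinates m n l) (enum {: _})
    by rewrite (perm_mem (coordinates_surj _ _ _)).
  by case/mapP=> y _ zy; exists y; rewrite -e zy.
- by case/chk.
- by case/chk => _ e _; rewrite e.
by case/chk=> _ _ e; rewrite (npairs_box_profile cr) (npairs_box_profile cr') e.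
Qed.

(* The Cayley graph of ('I_2 * 'I_2) * 'I_4 given by the two factors. *)
Definition rook_colour (x : coords) : nat :=
  let: (a, b, c) := x in
  let ab := (a == 0%N) && (b == 0%N) in
  if ab && (c == 0%N) then 0%N else if ab || (c == 0%N) then 1%N else 2%N.

(* The connection set is {(1, 0), (0, 1), (1, 1)} and the opposites; the factor 'I_1 only
   makes the two groups products of three cyclic groups. *)
Definition shrikhande_colour (x : coords) : nat :=
  let: (_, a, b) := x in
  if (a == 0%N) && (b == 0%N) then 0%N else
  if [|| a == 0%N, b == 0%N | a == b] && (odd a || odd b) then 1%N else 2%N.

Lemma rook_shrikhande_constants :
  same_colouring_constants 2 (1, 1, 3)%N (0, 3, 3)%N rook_colour shrikhande_colour.
Proof. by vm_compute. Qed.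

(** Each split selects two of the four lines [a = 0], [b = 0], [a = b], [a = -b] of C_3^2. *)
Definition split1 a b := (a == 0%N) || (b == 0%N).
Definition split2 a b := (b == 0%N) || (a == b :> nat).

(** [c0] and [c1] are the base-3 digits of [c]. Passing from [t = 1] to [t = 2] exchanges the halves
    of the split, so inversion exchanges the signs 1 and 2; sign 0 marks [a = b = 0]. *)
Definition glued_colour (split : nat -> nat -> bool) (x : coords) : nat :=
  let: (a, b, c) := x in
  let ab := (a == 0%N) && (b == 0%N) in
  let c0 := c %% 3 in let c1 := c %/ 3 in
  let sign (s : nat -> nat -> bool) t :=
    if ab then 0%N else if s a b == (t == 1%N) then 1%N else 2%N in
  if c0 != 0%N then (5 + sign split c0)%N else
  if c1 != 0%N then (2 + sign split1 c1)%N else if ab then 0%N else 1%N.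

Lemma glued_constants :
  same_colouring_constants 7 (2, 2, 8)%N (2, 2, 8)%N (glued_colour split2) (glued_colour split1).
Proof. by vm_compute. Qed.

(** * Excluding combinatorial isomorphisms by computation *)

Definition differences ns (col : coords -> nat) xs := [seq col (box_sub ns x y) | x <- xs, y <- xs].

Definition avoids ns ns' (col col' : coords -> nat) xs :=
  all (fun zs => differences ns' col' zs != differences ns col xs)
    (selections [seq [seq z <- box ns' | col' z == col x] | x <- xs]).

(** Translated so as to fix the identity, [h] would send [ts] to elements of the same colours with
    the same colours of differences; [avoids] excludes every such choice. *)
Lemma box_not_iso m n l m' n' l' r col col' (ts : seq ('I_m.+1 * 'I_n.+1 * 'I_l.+1)) :
  same_colouring_constants r (m, n, l) (m', n', l') col col' ->
  avoids (m, n, l) (m', n', l') col col' (map (@coordinates m n l) ts) ->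
  ~ exists h : 'I_m.+1 * 'I_n.+1 * 'I_l.+1 -> 'I_m'.+1 * 'I_n'.+1 * 'I_l'.+1,
      forall x y, inord (col' (coordinates (h y * (h x)^-1)))
                = inord (col (coordinates (y * x^-1))) :> 'I_r.+1.
Proof.
case/and5P=> /allP cr /allP cr' _ _ _ /allP avo [h hE].
have {}hE x y : col' (coordinates (h y * (h x)^-1)) = col (coordinates (y * x^-1)).
  by have /(congr1 val) := hE x y; rewrite (val_inord_colour cr) (val_inord_colour cr').
have mulC : commutative (@mulg ('I_m.+1 * 'I_n.+1 * 'I_l.+1)%type).
  by apply/abelian_mulgC; apply: pair_abelian; [apply: pair_abelian|]; exact: Zp_abelianT.
have mulC' : commutative (@mulg ('I_m'.+1 * 'I_n'.+1 * 'I_l'.+1)%type).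
  by apply/abelian_mulgC; apply: pair_abelian; [apply: pair_abelian|]; exact: Zp_abelianT.
pose f t := coordinates (h t * (h 1)^-1).
have := avo (map f ts); rewrite -map_comp.
rewrite selectionsP => [/(_ isT)/eqP[]|t _]; last first.
  by rewrite mem_filter mem_box hE invg1 mulg1 eqxx.
rewrite /differences !allpairs_mapl !allpairs_mapr.
apply: eq_allpairs => t u /=; rewrite -!coordinatesB invMg invgK.
by rewrite mulC' mulgA mulgKV hE mulC.
Qed.

Section ScaleLast.
Variables (gT : finGroupType) (p k : nat).
Hypothesis p1 : 1 < p.
Definition scale_last (x : gT * 'Z_(p ^ 2)) : gT * 'Z_(p ^ k.+2) := (x.1, Zp_scale k x.2).
Lemma scale_lastM : {morph scale_last : x y / x * y}.
Proof. by move=> x y; congr (_, _); exact: Zp_scaleM. Qed.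
Lemma scale_last_inj : injective scale_last.
Proof.
by move=> [a b] [c d] e; move: (congr1 fst e) (congr1 snd e) => /= -> /(Zp_scale_inj p1)->.
Qed.
End ScaleLast.

Lemma not_separable_Z2 k :
  ~ separable_group abelian_groups ('Z_2 * 'Z_2 * 'Z_(2 ^ k.+2))%type.
Proof.
have M2 := @scale_lastM ('Z_2 * 'Z_2)%type 2 k isT;
have I2 := @scale_last_inj ('Z_2 * 'Z_2)%type 2 k isT.
(* The Shrikhande graph lives on C_1 x C_4 x C_4, inside C_1 x C_4 x C_(2^(k+2)), which has the
   order of the first group. *)
have M4 := @scale_lastM ('I_1 * 'Z_4)%type 2 k isT;
have I4 := @scale_last_inj ('I_1 * 'Z_4)%type 2 k isT.
apply: (not_separable_extend M2 I2 M4 I4 _ (box_linked rook_shrikhande_constants)).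
- by rewrite !card_prod !card_ord.
- by apply: pair_abelian; [apply: pair_abelian|]; exact: Zp_abelianT.
(* 0 and these elements form a 4-clique. *)
apply: (box_not_iso rook_shrikhande_constants
  (ts := [:: (inZp 1, inZp 0, inZp 0); (inZp 0, inZp 1, inZp 0); (inZp 1, inZp 1, inZp 0)]%N)).
by vm_compute.
Qed.

Lemma not_separable_Z3 k :
  ~ separable_group abelian_groups ('Z_3 * 'Z_3 * 'Z_(3 ^ k.+2))%type.
Proof.
have M3 := @scale_lastM ('Z_3 * 'Z_3)%type 3 k isT;
have I3 := @scale_last_inj ('Z_3 * 'Z_3)%type 3 k isT.
apply: (not_separable_extend M3 I3 M3 I3 _ (box_linked glued_constants)) => //.
  by apply: pair_abelian; [apply: pair_abelian|]; exact: Zp_abelianT.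
(* Seen from the first two elements, of orders 3 and 9, the other two have the same sign
   for one split and opposite signs for the other one. *)
apply: (box_not_iso glued_constants
  (ts := [:: (inZp 0, inZp 0, inZp 3); (inZp 0, inZp 0, inZp 1);
             (inZp 1, inZp 0, inZp 0); (inZp 0, inZp 1, inZp 0)]%N)).
by vm_compute.
Qed.

Close Scope group_scope.

Theorem theorem1p2 (p k : nat) (hp : p = 2 \/ p = 3) (hk : 1 <= k) :
  separable_group abelian_groups ('Z_p * 'Z_p * 'Z_(p ^ k))%type <-> k = 1.
Proof.
split=> [|->]; last exact: separable_Zp.
case: k hk => [|[|k]] // _; case: hp => -> sep; exfalso.
  exact: not_separable_Z2 sep.
exact: not_separable_Z3 sep.
Qed.
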